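(* For every integer $k \ge 2$ and every $s \in \mathbb{N}$ there exist a $k$-partite $k$-graph $H$ of density at least $2^{-s-k}$ and a partition $\mathcal{V}_0$ of $V(H)$ with $|\mathcal{V}_0| \le 2^{200}k$, such that for every $\langle 2^{-16^k} \rangle$-regular partition $\mathcal{P}$ of $H$, if $\mathcal{P}^{(1)} \prec \mathcal{V}_0$ then $|\mathcal{P}^{(1)}| \ge \mathrm{Ack}_k(s)$.
   Context: **Ackermann functions.** $\mathrm{Ack}_1(x)=2^x$, and for $k\ge 1$, $\mathrm{Ack}_{k+1}(n)=\mathrm{Ack}_k(\mathrm{Ack}_k(\cdots(\mathrm{Ack}_k(1))\cdots))$ ($n$-fold composition of $\mathrm{Ack}_k$ applied to $1$). **Hypergraphs.** All hypergraphs are finite. A $k$-graph is a $k$-uniform hypergraph; hypergraphs are identified with their edge sets when convenient. It is $\ell$-partite on disjoint vertex classes $(V_1,\dots,V_\ell)$ if every edge has at most one vertex in each $V_i$. The density of a $k$-partite $k$-graph $H$ on $(V_1,\dots,V_k)$ is $e(H)/\prod_{i=1}^k|V_i|$, where $e(H)$ is the number of edges. For a bipartite graph $G$, $d_G(A,B)=e_G(A,B)/(|A||B|)$. For a partition $\mathcal{Z}$ of a set $V$, $\mathrm{Cross}_r(\mathcal{Z})$ is the set of $r$-element subsets of $V$ meeting each part of $\mathcal{Z}$ in at most one element. $\mathcal{Q}\prec\mathcal{P}$ means that every member of $\mathcal{Q}$ is contained in a member of $\mathcal{P}$. **Polyads.** An $r$-polyad is an $r$-partite $(r-1)$-graph $P$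 on vertex classes $(V_1,\dots,V_r)$; it is identified with the tuple $(F_1,\dots,F_r)$, where $F_i=P[\bigcup_{j\ne i}V_j]$ (a $2$-polyad is just a pair of disjoint vertex sets). $\mathcal{K}(P)$ is the set of $r$-element vertex subsets spanning a clique in $P$ (i.e. all of whose $(r-1)$-subsets are edges of $P$), viewed as an $r$-partite $r$-graph; for a $2$-polyad it is the complete bipartite graph. For a family of hypergraphs $\mathcal{P}$, $P$ is an $r$-polyad of $\mathcal{P}$ if every $F_i\in\mathcal{P}$. **$k$-partitions.** A $k$-partition ($k\ge1$) on $V$ is $\mathcal{P}=\mathcal{P}^{(1)}\cup\dots\cup\mathcal{P}^{(k)}$, where $\mathcal{P}^{(1)}$ is a partition of $V$ and, for $2\le r\le k$, $\mathcal{P}^{(r)}$ is a partition of $\mathrm{Cross}_r(\mathcal{P}^{(1)})$ into $r$-partite $r$-graphs with $\mathcal{P}^{(r)}\prec\{\mathcal{K}(P): P\text{ an }r\text{-polyad of }\mathcal{P}\}$. Each $F\in\mathcal{P}^{(r)}$ satisfies $F\subseteq\mathcal{K}(P)$ for a unique $r$-polyad $P$ of $\mathcal{P}$, denoted $U(F)$. **Graph $\langle\delta\rangle$-regularity.** A bipartite graph $G$ on $(A,B)$ is $\langle\delta\rangle$-regular if for all $A'\subseteq A$, $B'\subseteq B$ with $|A'|\ge\delta|A|$, $|B'|\ge\delta|B|$ we have $d_G(A',B')\ge\frac12 d_G(A,B)$. A vertex partition $\mathcal{P}$ of a graph $G$ is $\langle\delta\rangle$-regular if one can add/remove at most $\delta\cdot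 e(G)$ edges so that the bipartite graph induced on each $(A,B)$ with $A\ne B\in\mathcal{P}$ is $\langle\delta\rangle$-regular. **Auxiliary graphs.** For a $k$-partite $k$-graph $H$ on $(V_1,\dots,V_k)$ and $1\le i\le k$, $G_H^i$ is the bipartite graph on $(\prod_{j\ne i}V_j,\,V_i)$ in which $((v_j)_{j\ne i},v_i)$ is an edge iff $(v_1,\dots,v_k)\in E(H)$. If $H\subseteq\mathcal{K}(P)$ for a $k$-polyad $P=(F_1,\dots,F_k)$, then $G^i_{H,P}=G^i_H[F_i,V_i]$ is the induced subgraph. **Good and regular partitions.** A $k$-partition $\mathcal{P}$ is $\langle\delta\rangle$-good if for every $2\le r\le k$, every $F\in\mathcal{P}^{(r)}$ and every $1\le i\le r$, the bipartite graph $G^i_{F,U(F)}$ is $\langle\delta\rangle$-regular. For a $(k-1)$-partition $\mathcal{P}$ with $\mathcal{P}^{(1)}\prec\{V_1,\dots,V_k\}$ let $V_i(\mathcal{P})=\{Z\in\mathcal{P}^{(1)}: Z\subseteq V_i\}$ and $E_i(\mathcal{P})=\{E\in\mathcal{P}^{(k-1)}: E\subseteq\prod_{j\ne i}V_j\}$. For a $k$-partite $k$-graph $H$ on $(V_1,\dots,V_k)$, a $\langle\delta\rangle$-regular partition of $H$ is a $\langle\delta\rangle$-good $(k-1)$-partition $\mathcal{P}$ on $V(H)$ with $\mathcal{P}^{(1)}\prec\{V_1,\dots,V_k\}$ such that for every $1\le i\le k$, $E_i(\mathcal{P})\cup V_i(\mathcal{P})$ is a $\langle\delta\rangle$-regular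 partition of the graph $G_H^i$. *)

(* Defs.v *)
From mathcomp Require Import all_boot all_order all_algebra.
Set Implicit Arguments.
Unset Strict Implicit.
Unset Printing Implicit Defensive.
Import Order.TTheory GRing.Theory Num.Theory.

(* Only k >= 1 is meaningful; the value at k = 0 is junk. *)
Fixpoint Ack (k n : nat) : nat :=
  match k with
  | 0 => 0
  | 1 => 2 ^ n
  | k'.+1 => iter n (Ack k') 1
  end.

(* A hypergraph on vertices in T is its edge set, of type {set {set T}}; a
   tuple (v_j)_j of vertices taken from disjoint classes is identified with the
   set of its entries. *)
Section Hypergraphs.
Variable T : finType.
Implicit Types (Q R : {set {set T}}) (H E : {set {set T}}).

Definition refines Q R : Prop :=
  forall A : {set T}, A \in Q -> exists2 B : {set T}, B \in R & A \subset B.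

Definition disjoint_classes l (W : 'I_l -> {set T}) : Prop :=
  forall i j : 'I_l, i != j -> [disjoint W i & W j].

(* E is an r-graph that is l-partite on the vertex classes W. *)
Definition partite r l (W : 'I_l -> {set T}) E : Prop :=
  disjoint_classes W /\
  forall e : {set T}, e \in E ->
    [/\ #|e| = r, e \subset \bigcup_i W i & forall i, #|e :&: W i| <= 1].

(* \prod_(j | J j) W j, for pairwise disjoint classes W. *)
Definition prod_edges l (W : 'I_l -> {set T}) (J : pred 'I_l) : {set {set T}} :=
  [set e : {set T} | (e \subset \bigcup_(j | J j) W j) &&
                     [forall j, J j ==> (#|e :&: W j| == 1)]].

Definition density k (V : 'I_k -> {set T}) H : rat :=
  (#|H|%:R / (\prod_i #|V i|)%N%:R)%R.

Definition Cross r (S : {set T}) Q : {set {set T}} :=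
  [set e : {set T} | [&& e \subset S, #|e| == r &
                      [forall Z in Q, #|e :&: Z| <= 1]]].

Definition polyad r (W : 'I_r -> {set T}) E : Prop := partite r.-1 W E.

Definition polyad_part r (W : 'I_r -> {set T}) E (i : 'I_r) : {set {set T}} :=
  [set e in E | e \subset \bigcup_(j | j != i) W j].

(* Meeting every class exactly once is automatic for r >= 3; for r = 2 it makes
   K(P) the complete bipartite graph between the two classes. *)
Definition cliques r (W : 'I_r -> {set T}) E : {set {set T}} :=
  [set e in prod_edges W predT |
    [forall e' : {set T}, (e' \subset e) && (#|e'| == r.-1) ==> (e' \in E)]].

End Hypergraphs.

Section Graphs.
Variable X : finType.
Implicit Types (G : {set {set X}}) (A B : {set X}).

Definition graph_on (VG : {set X}) G : Prop :=
  forall f : {set X}, f \in G -> f \subset VG /\ #|f| = 2.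

Definition edges_between G A B : nat :=
  #|[set p in setX A B | [set p.1; p.2] \in G]|.

Definition pair_density G A B : rat :=
  ((edges_between G A B)%:R / (#|A| * #|B|)%N%:R)%R.

(* For disjoint A and B: the bipartite graph on (A, B) induced by G is
   <d>-regular. *)
Definition regular_pair (d : rat) G A B : Prop :=
  forall A' B' : {set X}, A' \subset A -> B' \subset B ->
    (d * #|A|%:R <= #|A'|%:R)%R -> (d * #|B|%:R <= #|B'|%:R)%R ->
    (2%:R^-1 * pair_density G A B <= pair_density G A' B')%R.

(* G' is the graph obtained from G by adding and removing edges. *)
Definition regular_vertex_partition (d : rat) (VG : {set X}) G
    (Q : {set {set X}}) : Prop :=
  partition Q VG /\
  exists G' : {set {set X}},
    [/\ graph_on VG G',
        (#|(G :\: G') :|: (G' :\: G)|%:R <= d * #|G|%:R)%R &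
        forall A B, A \in Q -> B \in Q -> A != B -> regular_pair d G' A B].

End Graphs.

Section Partitions.
Variable T : finType.
Implicit Types (H F E : {set {set T}}).

Definition aux_left (A : {set {set T}}) : {set {set T} + T} := [set inl e | e in A].
Definition aux_right (B : {set T}) : {set {set T} + T} := [set inr v | v in B].

(* The bipartite graph G_H^i on (\prod_(j != i) V_j, V_i). *)
Definition aux_vertices k (V : 'I_k -> {set T}) (i : 'I_k) : {set {set T} + T} :=
  aux_left (prod_edges V [pred j | j != i]) :|: aux_right (V i).

Definition aux_graph k (V : 'I_k -> {set T}) H (i : 'I_k) :
    {set {set ({set T} + T)%type}} :=
  [set [set inl p.1; inr p.2] | p : {set T} * T in
     [set q | [&& q.1 \in prod_edges V [pred j | j != i], q.2 \in V i &
                  q.2 |: q.1 \in H]]].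

(* vparts is P^(1), as a partition of the vertex set; hparts r is P^(r), and is
   relevant for r >= 2 only. *)
Record kpart := KPart {
  vparts : {set {set T}};
  hparts : nat -> {set {set {set T}}} }.

(* P^(r) as a set of r-graphs: for r = 1, a vertex set Z is identified with the
   1-graph {{z} : z in Z}. *)
Definition level (P : kpart) (r : nat) : {set {set {set T}}} :=
  if r == 1 then [set [set [set z] | z in Z : {set T}] | Z : {set T} in vparts P]
  else hparts P r.

Definition in_kpart (k : nat) (P : kpart) F : Prop :=
  exists r, 1 <= r <= k /\ F \in level P r.

(* The vertex classes of the members of P^(r) are members of P^(1), hence so
   are the classes of a polyad of P. *)
Definition polyad_of (k : nat) (P : kpart) r (W : 'I_r -> {set T}) E : Prop :=
  [/\ polyad W E,
      forall i, W i \in vparts P &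
      forall i, in_kpart k P (polyad_part W E i)].

(* For a k-partition P, (W, E) is U(F): it is unique up to the order of its classes. *)
Definition under (k : nat) (P : kpart) r F (W : 'I_r -> {set T}) E : Prop :=
  polyad_of k P W E /\ F \subset cliques W E.

(* The members of level P r are r-partite r-graphs because cliques W E is. *)
Definition kpartition (k : nat) (S : {set T}) (P : kpart) : Prop :=
  partition (vparts P) S /\
  forall r, 2 <= r <= k ->
    partition (level P r) (Cross r S (vparts P)) /\
    forall F, F \in level P r ->
      exists (W : 'I_r -> {set T}) (E : {set {set T}}), under k P F W E.

Definition good (k : nat) (d : rat) (P : kpart) : Prop :=
  forall r, 2 <= r <= k ->
  forall F, F \in level P r ->
  forall (W : 'I_r -> {set T}) (E : {set {set T}}), under k P F W E ->
  forall i : 'I_r,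
    regular_pair d (aux_graph W F i)
      (aux_left (polyad_part W E i)) (aux_right (W i)).

(* E_i(P) :|: V_i(P), as a set of vertex sets of G_H^i. *)
Definition aux_partition k (V : 'I_k -> {set T}) (P : kpart) (i : 'I_k) :
    {set {set ({set T} + T)%type}} :=
  [set aux_left F | F in
     [set F in level P k.-1 | F \subset prod_edges V [pred j | j != i]]] :|:
  [set aux_right Z | Z in [set Z in vparts P | Z \subset V i]].

Definition regular_partition k (d : rat) (V : 'I_k -> {set T}) H
    (P : kpart) : Prop :=
  [/\ kpartition k.-1 (\bigcup_i V i) P,
      good k.-1 d P,
      refines (vparts P) [set V i | i : 'I_k] &
      forall i : 'I_k,
        regular_vertex_partition d (aux_vertices V i) (aux_graph V H i)
          (aux_partition V P i)].

End Partitions.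

(* Main.v *)
(* Vertices are pairs (class, string of bits), with [2 k] cyclically ordered
   classes.  A graph between [X] and [Y], both labelled by blocks of bits, is cut
   out by "patterns": the bit [t] of a pair is [f_t (block t of x, block t of y)],
   where [f_t] is a code of linear rate.  Its codewords are indexed by the blocks
   of [x] and its coordinates by those of [y], so the former have about
   [2 ^ d / 8] bits if the latter have [d]; codewords are far apart, and the
   coordinates are balanced and pairwise independent.  If a partition of [Y]
   approximately refines the first [t] blocks, a part of [X] with points whose
   labels differ in the first [t] blocks contains pairs whose
   neighbourhoods differ on many cells of [Y]; there one of them has no edges,
   and regularity is violated unless many edges are edited.  So a regular
   partition of [X] must approximately refine one more, exponentially longer,
   block.  A second moment estimate shows that the exceptional set of [Y] hides
   the neighbourhood of few points only, which keeps the error from accumulating.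

   Bits of pairs are again bits, so the construction is iterated: the bits of
   [r]-tuples play the role of [X] and the next class that of [Y].  A good
   partition whose [r]-edges refine [j] bits is approximately regular for one of
   the [2 ^ j] graphs cut out by these bits, and so forces refinement one level
   down; by cyclic symmetry all classes then gain the same number of vertex bits,
   and the next round starts.  One round at uniformity [r + 1] costs an
   exponential number of rounds at uniformity [r], hence the Ackermann growth. *)
Require Import Defs.
From mathcomp Require Import all_boot all_order all_algebra.
From mathcomp Require Import ring lra zify.
Set Implicit Arguments.
Unset Strict Implicit.
Unset Printing Implicit Defensive.
Import Order.TTheory GRing.Theory Num.Theory.

Local Open Scope ring_scope.

(** * Averages over bit sequences *)

Section Average.
Variable R : realFieldType.

(** Expectation over uniformly random strings of length [n]. The recursion runs over plain
    sequences, so strings can be cut and concatenated without casts between tuple types. *)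
Fixpoint avg (n : nat) (F : seq bool -> R) : R :=
  if n is n'.+1 then
    (avg n' (fun s => F (true :: s)) + avg n' (fun s => F (false :: s))) / 2%:R
  else F [::].

Lemma eq_avg n F G : (forall s, size s = n -> F s = G s) -> avg n F = avg n G.
Proof.
elim: n F G => [|n IH] F G eFG /=; first exact: eFG.
by congr ((_ + _) / _); apply: IH => s sz; apply: eFG; rewrite /= sz.
Qed.

Lemma avgD n F G : avg n (fun s => F s + G s) = avg n F + avg n G.
Proof. by elim: n F G => [|n IH] F G //=; rewrite !IH; lra. Qed.

Lemma avgZ n c F : avg n (fun s => c * F s) = c * avg n F.
Proof. by elim: n F => [|n IH] F //=; rewrite !IH; lra. Qed.

Lemma avgZr n c F : avg n (fun s => F s * c) = avg n F * c.
Proof. by elim: n F => [|n IH] F //=; rewrite !IH; lra. Qed.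

Lemma avg_const n c : avg n (fun=> c) = c.
Proof. by elim: n => [|n IH] //=; rewrite !IH; lra. Qed.

Lemma le_avg n F G :
  (forall s, size s = n -> F s <= G s) -> avg n F <= avg n G.
Proof.
elim: n F G => [|n IH] F G leFG /=; first exact: leFG.
have h b : avg n (fun s => F (b :: s)) <= avg n (fun s => G (b :: s)).
  by apply: IH => s sz; apply: leFG; rewrite /= sz.
by have := h true; have := h false; lra.
Qed.

Lemma avg_sum n (I : Type) (r : seq I) (P : pred I) (F : I -> seq bool -> R) :
  avg n (fun s => \sum_(i <- r | P i) F i s) = \sum_(i <- r | P i) avg n (F i).
Proof.
elim: n F => [|n IH] F //=.
by rewrite !IH -big_split /= mulr_suml.
Qed.

Lemma exists_le_avg n F c :
  avg n F <= c -> exists2 s, size s = n & F s <= c.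
Proof.
elim: n F => [|n IH] F /= le_c; first by exists [::].
have [lt_c|le_c'] := lerP (avg n (fun s => F (true :: s))) c.
  by have [s sz Fs] := IH _ lt_c; exists (true :: s); rewrite //= sz.
have /IH [s sz Fs] : avg n (fun s => F (false :: s)) <= c by lra.
by exists (false :: s); rewrite //= sz.
Qed.

Lemma avg_cat p q F :
  avg (p + q) F = avg p (fun s => avg q (fun s' => F (s ++ s'))).
Proof. by elim: p F => [|p IH] F //=; rewrite !IH. Qed.

Lemma avg_rcons n F :
  avg n.+1 F = avg n (fun s => (F (rcons s true) + F (rcons s false)) / 2%:R).
Proof.
rewrite -addn1 avg_cat; apply: eq_avg => s _ /=.
by rewrite !cats1.
Qed.

Lemma avg_eq n a : avg n (fun s => (s == a)%:R) = (size a == n)%:R / 2%:R ^+ n.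
Proof.
elim: n a => [|n IH] [|b a] //=; rewrite ?expr0 ?divr1 //.
  by rewrite !avg_const; lra.
under eq_avg do rewrite eqseq_cons.
under [X in _ + X]eq_avg do rewrite eqseq_cons.
rewrite eqSS exprS; case: b; rewrite /= IH avg_const.
  by rewrite addr0 -mulrA -invfM mulrC [2 ^+ n * _]mulrC -mulrC.
by rewrite add0r -mulrA -invfM mulrC [2 ^+ n * _]mulrC -mulrC.
Qed.

Lemma sum_tuple_avg n (F : seq bool -> R) :
  \sum_(v : n.-tuple bool) F v = 2%:R ^+ n * avg n F.
Proof.
elim: n F => [|n IH] F.
  rewrite (eq_bigr (fun=> F [::])) => [|v _]; last by rewrite tuple0.
  by rewrite sumr_const card_tuple expn0 mulr1n expr0 mul1r.
have bij : {on [pred _ | true], bijective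
    (fun p : bool * n.-tuple bool => [tuple of p.1 :: p.2])}.
  exists (fun v => (thead v, [tuple of behead v])).
    by move=> [b v] _; rewrite theadE; congr (_, _); apply: val_inj.
  by move=> v _; rewrite [RHS]tuple_eta; apply: val_inj.
rewrite (reindex _ bij) /=.
rewrite -(pair_bigA _ (fun b (v : n.-tuple bool) => F (b :: v))) /= big_bool /=.
rewrite (IH (fun s => F (true :: s))) (IH (fun s => F (false :: s))) exprS.
by field.
Qed.

(** * Consecutive blocks of a bit string *)

Section Blocks.
Implicit Types (d : nat -> nat) (s : seq bool).

Definition offset d t := (\sum_(i < t) d i)%N.

Definition block d t s := take (d t) (drop (offset d t) s).

Lemma offset0 d : offset d 0 = 0%N. Proof. exact: big_ord0. Qed.

Lemma offsetS d t : offset d t.+1 = (offset d t + d t)%N.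
Proof. exact: big_ord_recr. Qed.

Lemma offset_mono d t u : (t <= u)%N -> (offset d t <= offset d u)%N.
Proof.
elim: u => [|u IH]; first by rewrite leqn0 => /eqP->.
rewrite leq_eqVlt => /orP[/eqP->//|/IH le_tu].
by rewrite offsetS (leq_trans le_tu) // leq_addr.
Qed.

Lemma size_block d t s : (offset d t.+1 <= size s)%N -> size (block d t s) = d t.
Proof.
rewrite offsetS => le_s; rewrite size_takel // size_drop.
by rewrite leq_subRL ?(leq_trans (leq_addr _ _) le_s).
Qed.

Lemma block_cat d t s s' :
  (offset d t.+1 <= size s)%N -> block d t (s ++ s') = block d t s.
Proof.
rewrite offsetS => le_s; have le_o := leq_trans (leq_addr _ _) le_s.
rewrite /block drop_cat; case: ltnP => [lt_o|ge_o].
  rewrite take_cat size_drop; case: ltnP => // ge_d.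
  have e : (size s - offset d t)%N = d t.
    by apply/eqP; rewrite eqn_leq ge_d leq_subRL.
  by rewrite e subnn take0 cats0 take_oversize // size_drop e.
(* Here [s] ends where block [t] starts, which forces the block to be empty. *)
have e : offset d t = size s by apply/eqP; rewrite eqn_leq le_o ge_o.
have /eqP-> : d t == 0%N by rewrite -leqn0 -(leq_add2l (size s)) addn0 -{1}e.
by rewrite !take0.
Qed.

Lemma block_last d t s s' :
  size s = offset d t -> size s' = d t -> block d t (s ++ s') = s'.
Proof. by move=> sz sz'; rewrite /block drop_size_cat // take_oversize ?sz'. Qed.

Lemma block_take d t u s :
  (t < u)%N -> block d t (take (offset d u) s) = block d t s.
Proof.
move=> lt_tu; have : (offset d t.+1 <= offset d u)%N by exact: offset_mono.
by rewrite offsetS addnC => le_u; rewrite /block !take_drop take_takel.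
Qed.

Lemma eq_take_blocks d t s s' :
  (offset d t <= size s)%N -> (offset d t <= size s')%N ->
  (forall i, (i < t)%N -> block d i s = block d i s') ->
  take (offset d t) s = take (offset d t) s'.
Proof.
elim: t => [|t IH] le_s le_s' eqb; first by rewrite offset0 !take0.
have le u : (offset d t.+1 <= size u -> offset d t <= size u)%N.
  by apply: leq_trans; exact: offset_mono.
rewrite offsetS !takeD IH ?le //; last by move=> i lti; apply: eqb; exact: ltnW.
by congr (_ ++ _); exact: eqb.
Qed.

Lemma avg_prefix p N (F : seq bool -> R) : (p <= N)%N ->
  (forall s s', size s = p -> F (s ++ s') = F s) -> avg N F = avg p F.
Proof.
move=> le_pN F_pre; rewrite -(subnKC le_pN) avg_cat; apply: eq_avg => s sz.
by under eq_avg do rewrite F_pre //; rewrite avg_const.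
Qed.

Lemma avg_blocks d T N (phi : nat -> seq bool -> R) :
  (offset d T <= N)%N ->
  avg N (fun s => \prod_(t < T) phi t (block d t s)) =
  \prod_(t < T) avg (d t) (phi t).
Proof.
have pre n s s' : size s = offset d n ->
    \prod_(t < n) phi t (block d t (s ++ s')) = \prod_(t < n) phi t (block d t s).
  by move=> sz; apply: eq_bigr => t _; rewrite block_cat // sz offset_mono.
move=> leN; rewrite (avg_prefix leN) => [|s s']; last exact: pre.
elim: T {leN} => [|T IH]; first by rewrite offset0 /= !big_ord0.
rewrite offsetS avg_cat big_ord_recr /= -IH -avgZr.
apply: eq_avg => s sz; rewrite -avgZ; apply: eq_avg => s' sz'.
by rewrite big_ord_recr /= block_last // pre.
Qed.

(** Distinct blocks of a random string are independent, so balanced functions of them are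
    independent fair bits. *)
Lemma avg_bits_blocks d T N (g : nat -> seq bool -> bool) (F : seq bool -> R) :
  (offset d T <= N)%N ->
  (forall t, (t < T)%N -> avg (d t) (fun a => (g t a)%:R) = 2%:R^-1 :> R) ->
  avg N (fun s => F (mkseq (fun t => g t (block d t s)) T)) = avg T F.
Proof.
have pre n s s' : size s = offset d n ->
    mkseq (fun t => g t (block d t (s ++ s'))) n = mkseq (fun t => g t (block d t s)) n.
  move=> sz; apply/eq_in_map => t; rewrite mem_iota => /andP[_ ltn].
  by rewrite block_cat // sz offset_mono.
move=> leN g_half; rewrite (avg_prefix leN) => [|s s' sz]; last by rewrite pre.
elim: T F g_half {leN} => [|T IH] F g_half; first by rewrite offset0.
rewrite offsetS avg_cat avg_rcons -IH; last by move=> t /ltnW; exact: g_half.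
apply: eq_avg => s sz.
(* A function of one bit is affine in it, so its mean depends on the mean of the bit only. *)
rewrite (@eq_avg _ (fun s' => F (mkseq (fun t => g t (block d t (s ++ s'))) T.+1))
  (fun s' => F (rcons (mkseq (fun t => g t (block d t s)) T) false) +
    (F (rcons (mkseq (fun t => g t (block d t s)) T) true) -
     F (rcons (mkseq (fun t => g t (block d t s)) T) false)) * (g T s')%:R)).
  by rewrite avgD avgZ avg_const g_half //; field.
move=> s' sz'; rewrite mkseqS pre // block_last //.
by case: (g T s'); rewrite /= ?mulr1 ?mulr0 ?addr0 // addrC subrK.
Qed.

End Blocks.

End Average.

(** * Codes *)

Section Patterns.
Variable R : realFieldType.
Local Notation avg := (@avg R).

(** The word [f x] has the [2 ^ d] coordinates [a]. [pattern_row] makes the bits of pairs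
    equidistributed, [pattern_col] and [pattern_pair] supply first and second moments over [x], and
    [pattern_sep] is a relative minimum distance of 1/8. *)
Record pattern (b d : nat) (f : seq bool -> seq bool -> bool) : Prop := Pattern {
  pattern_row : forall x, size x = b -> avg d (fun a => (f x a)%:R) = 2%:R^-1;
  pattern_col : forall a, size a = d -> avg b (fun x => (f x a)%:R) = 2%:R^-1;
  pattern_pair : forall a a' e, size a = d -> size a' = d -> a != a' ->
    avg b (fun x => ((f x a == e) && (f x a' == e))%:R) <= 4%:R^-1;
  pattern_sep : forall x y, size x = b -> size y = b -> x != y ->
    8%:R^-1 <= avg d (fun a => (f x a != f y a)%:R) }.

Fixpoint dot (x y : seq bool) : bool :=
  match x, y with
  | a :: x', b :: y' => (a && b) (+) dot x' y'
  | _, _ => false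
  end.

Definition xors (x y : seq bool) : seq bool :=
  [seq p.1 (+) p.2 | p <- zip x y].

Lemma dotC x y : dot x y = dot y x.
Proof. by elim: x y => [|a x IH] [|b y] //=; rewrite IH andbC. Qed.

Lemma dot_xors x y z :
  size y = size z -> dot x (xors y z) = dot x y (+) dot x z.
Proof.
elim: x y z => [|a x IH] [|b y] [|c z] //= [sz]; rewrite -/(xors y z) (IH y z sz).
by case: a b c (dot x y) (dot x z) => [] [] [] [] [].
Qed.

Lemma size_xors x y : size x = size y -> size (xors x y) = size x.
Proof. by move=> sz; rewrite size_map size_zip sz minnn. Qed.

Lemma xors_eq0 x y :
  size x = size y -> (xors x y == nseq (size x) false) = (x == y).
Proof.
elim: x y => [|a x IH] [|b y] //= [sz].
by rewrite -/(xors x y) !eqseq_cons IH //; case: a b => [] [].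
Qed.

(** Orthogonality: a nontrivial character of the group of bit strings averages to zero. *)
Lemma avg_dot_sign n y : size y = n ->
  avg n (fun x => (-1) ^+ dot x y) = (y == nseq n false)%:R.
Proof.
elim: n y => [|n IH] [|b y] //= [sz].
under eq_avg do rewrite signr_addb.
rewrite avgZ IH // eqseq_cons.
by case: b => /=; rewrite ?expr0 ?expr1; [lra | case: (_ == _) => /=; lra].
Qed.

Lemma avg_dot n y : size y = n -> y != nseq n false ->
  avg n (fun x => (dot x y)%:R) = 2%:R^-1.
Proof.
move=> sz /negPf nz.
rewrite (@eq_avg _ _ _ (fun x => 2%:R^-1 + (- 2%:R^-1) * (-1) ^+ dot x y)) => [|x _].
  by rewrite avgD avgZ avg_const avg_dot_sign // nz /=; lra.
by case: (dot x y); rewrite /= ?expr0 ?expr1; lra.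
Qed.

(** The indicator of two prescribed bits expands into four characters; [y], [y'] and their sum are
    nonzero, so only the constant term 1/4 survives. *)
Lemma avg_dot_pair n y y' e e' : size y = n -> size y' = n -> y != y' ->
  y != nseq n false -> y' != nseq n false ->
  avg n (fun x => ((dot x y == e) && (dot x y' == e'))%:R) = 4%:R^-1.
Proof.
move=> sz sz' ne nz nz'.
have nx : xors y y' != nseq n false.
  by rewrite -sz xors_eq0 // sz.
rewrite (@eq_avg _ _ _ (fun x => 4%:R^-1 + ((-1) ^+ e / 4%:R) * (-1) ^+ dot x y
   + ((-1) ^+ e' / 4%:R) * (-1) ^+ dot x y'
   + ((-1) ^+ e * (-1) ^+ e' / 4%:R) * (-1) ^+ dot x (xors y y'))) => [|x szx].
  rewrite !avgD !avgZ avg_const !avg_dot_sign ?size_xors ?sz //.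
  by rewrite (negPf nz) (negPf nz') (negPf nx) /=; lra.
rewrite dot_xors ?sz ?sz' //.
case: (dot x y); case: (dot x y'); case: e; case: e';
  rewrite /= ?expr0 ?expr1 /=; lra.
Qed.

(* Each column of the linear code also occurs complemented: this balances the
   rows and leaves the relative distance unchanged. *)
Definition code_pattern (g : seq bool -> seq bool) (x a : seq bool) : bool :=
  if a is e :: a' then e (+) dot x (g a') else false.

(** Nonzero columns are balanced and distinct nonzero columns are independent, while linearity turns
    the lower bound on weights into one on distances. *)
Lemma code_patternP b d (g : seq bool -> seq bool) :
  (forall a, size a = d -> size (g a) = b /\ g a != nseq b false) ->
  (forall a a', size a = d -> size a' = d -> a != a' -> g a != g a') ->
  (forall z, size z = b -> z != nseq b false ->
     8%:R^-1 <= avg d (fun a => (dot z (g a))%:R)) ->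
  pattern b d.+1 (code_pattern g).
Proof.
move=> g_nz g_inj g_wt; split.
- move=> x szx /=.
  rewrite (@eq_avg _ _ (fun s => (~~ dot x (g s))%:R)
     (fun s => 1 + (-1) * (dot x (g s))%:R)) => [|s _]; last first.
    by case: (dot _ _) => /=; lra.
  by rewrite avgD avgZ avg_const; lra.
- move=> [//|e a] [sza] /=; have [szg nz] := g_nz a sza.
  have := avg_dot szg nz; case: e => //= eq_avg_dot.
  rewrite (@eq_avg _ _ _ (fun x => 1 + (-1) * (dot x (g a))%:R)) => [|s _].
    by rewrite avgD avgZ avg_const eq_avg_dot; lra.
  by case: (dot _ _) => /=; lra.
- move=> [|e1 a] [|e2 a'] e //= [sza] [sza'].
  rewrite eqseq_cons negb_and.
  have [<-{a' sza'}|ne_a _] := eqVneq a a'.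
    (* A column and its complement never take the value [e] together. *)
    rewrite orbF => ne_e; rewrite (@eq_avg _ _ _ (fun=> 0)) => [|x _].
      by rewrite avg_const; lra.
    by move: ne_e; case: e1 e2 e (dot _ _) => [] [] [] [].
  have [szg nz] := g_nz a sza; have [szg' nz'] := g_nz a' sza'.
  rewrite le_eqVlt -(avg_dot_pair (e (+) e1) (e (+) e2) szg szg'
    (g_inj _ _ sza sza' ne_a) nz nz'); apply/orP; left; apply/eqP.
  apply: eq_avg => x _; congr (_%:R); congr nat_of_bool.
  by move: e1 e2 e (dot _ _) (dot _ _) => [] [] [] [] [].
move=> x y szx szy ne_xy /=.
have szxy : size x = size y by rewrite szx szy.
(* The difference of two rows is the row of their sum, and the complement bit cancels. *)
have e b' s : ((b' (+) dot x (g s)) != (b' (+) dot y (g s))) = dot (xors x y) (g s).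
  rewrite [RHS]dotC dot_xors // ![dot (g s) _]dotC.
  by move: b' (dot _ _) (dot _ _) => [] [] [].
have e' b' : avg d (fun s => (code_pattern g x (b' :: s)
    != code_pattern g y (b' :: s))%:R) = avg d (fun s => (dot (xors x y) (g s))%:R).
  by apply: eq_avg => s _; rewrite -(e b').
rewrite (e' true) (e' false).
have szz : size (xors x y) = b by rewrite size_xors.
have nz : xors x y != nseq b false by rewrite -szx xors_eq0.
by have := g_wt _ szz nz; lra.
Qed.

(** The values of a uniformly random function are independent and uniform; the prefactor counts the
    functions. *)
Lemma sum_ffun_avg (A : finType) b (phi : A -> seq bool -> R) :
  \sum_(g : {ffun A -> b.-tuple bool}) \prod_a phi a (g a) =
  (2%:R ^+ b) ^+ #|A| * \prod_a avg b (phi a).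
Proof.
rewrite -(bigA_distr_bigA (fun a v => phi a (val v))) -prodr_const.
rewrite (eq_bigl predT) // -big_split /=; apply: eq_bigr => a _.
exact: sum_tuple_avg.
Qed.

Lemma exists_sum_lt1 (I : finType) (F : I -> R) : 
  \sum_i F i < #|I|%:R -> exists i, F i < 1.
Proof.
move=> lt_sum; apply/existsP; apply: contraLR lt_sum.
rewrite negb_exists -leNgt => /forallP h.
rewrite -sum1_card natr_sum; apply: ler_sum => i _.
by have := h i; rewrite -leNgt.
Qed.

Lemma prod_delta (A : finType) (a : A) (c : R) :
  \prod_a' (if a' == a then c else 1) = c.
Proof. by rewrite (bigD1 a) //= eqxx big1 ?mulr1 // => a' /negPf->. Qed.

Lemma prod_delta2 (A : finType) (a a' : A) (c : R) : a != a' ->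
  \prod_x (if (x == a) || (x == a') then c else 1) = c ^+ 2.
Proof.
move=> ne; rewrite (bigD1 a) //= eqxx (bigD1 a') /=; last by rewrite eq_sym.
rewrite eqxx orbT big1 ?mulr1 ?expr2 // => x /andP[/negPf-> /negPf->].
by [].
Qed.

Lemma sum_ffun_eq (A : finType) b (a : A) (y : seq bool) : size y = b ->
  \sum_(g : {ffun A -> b.-tuple bool}) (val (g a) == y)%:R =
  (2%:R ^+ b) ^+ #|A| / 2%:R ^+ b :> R.
Proof.
move=> szy.
transitivity (\sum_(g : {ffun A -> b.-tuple bool})
    \prod_a' (if a' == a then (val (g a') == y)%:R else 1 : R)).
  apply: eq_bigr => g _.
  by rewrite -[LHS](prod_delta a); apply: eq_bigr => a' _; case: eqP => [->|].
rewrite (sum_ffun_avg b (fun a' v => if a' == a then (v == y)%:R else 1)).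
congr (_ * _); rewrite -[RHS](prod_delta a); apply: eq_bigr => a' _.
by case: eqP => _; rewrite ?avg_const // avg_eq szy eqxx div1r.
Qed.

Lemma sum_ffun_coll (A : finType) b (a a' : A) : a != a' ->
  \sum_(g : {ffun A -> b.-tuple bool}) (g a == g a')%:R =
  (2%:R ^+ b) ^+ #|A| / 2%:R ^+ b :> R.
Proof.
move=> ne.
(* A collision is split by the common value, which turns it into a product over the arguments of
   [g]. *)
transitivity (\sum_(v : b.-tuple bool) \sum_(g : {ffun A -> b.-tuple bool})
    \prod_x (if (x == a) || (x == a') then (val (g x) == v)%:R else 1 : R)).
  rewrite exchange_big /=; apply: eq_bigr => g _.
  rewrite (bigD1 (g a)) //= [X in _ + X]big1 ?addr0 => [|v /negPf nv].
    rewrite (bigD1 a) //= (bigD1 a') /=; last by rewrite eq_sym.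
    rewrite !eqxx orbT mul1r eq_sym big1 ?mulr1 // => x /andP[/negPf-> /negPf->].
    by [].
  rewrite (bigD1 a) //= eqxx /=.
  suff -> : (val (g a) == v) = false by rewrite mul0r.
  by rewrite -nv eq_sym.
transitivity (\sum_(v : b.-tuple bool)
    (2%:R ^+ b) ^+ #|A| * ((2%:R ^+ b)^-1) ^+ 2 : R).
  apply: eq_bigr => v _.
  rewrite (sum_ffun_avg b
    (fun x w => if (x == a) || (x == a') then (w == v)%:R else 1)).
  congr (_ * _); rewrite -(prod_delta2 _ ne); apply: eq_bigr => x _.
  by case: ifP => _; rewrite ?avg_const // avg_eq size_tuple eqxx div1r.
rewrite sumr_const card_tuple card_bool -[LHS]mulr_natr natrX.
have : 2%:R ^+ b != 0 :> R by rewrite expf_neq0 // pnatr_eq0.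
by move: (2%:R ^+ b) => K nzK; field.
Qed.

(** Exponential moment of the weight of the codeword of [z], for a Chernoff bound: each coordinate
    is a fair bit and contributes a factor of mean (1 + 1/3) / 2 = 2/3. *)
Lemma sum_ffun_wt (A : finType) b (z : seq bool) : size z = b ->
  z != nseq b false ->
  \sum_(g : {ffun A -> b.-tuple bool}) \prod_a (3%:R^-1) ^+ dot z (g a) =
  (2%:R ^+ b) ^+ #|A| * (2%:R / 3%:R) ^+ #|A| :> R.
Proof.
move=> szz nz; rewrite (sum_ffun_avg b (fun=> fun v => (3%:R^-1) ^+ dot z v)).
congr (_ * _); rewrite -prodr_const; apply: eq_bigr => a _.
rewrite (@eq_avg _ _ _ (fun v => 1 + (- (2%:R / 3%:R)) * (dot v z)%:R)) => [|v _].
  by rewrite avgD avgZ avg_const avg_dot //; lra.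
by rewrite dotC; case: (dot _ _); rewrite /= ?expr0 ?expr1; lra.
Qed.

Lemma sq_le_exp4 (u : nat) : (8 <= u)%N -> (256 * u ^ 2 <= 4 ^ u)%N.
Proof.
elim: u => // u IH; rewrite leq_eqVlt => /orP[/eqP<-//|lt8].
have /IH le_u : (8 <= u)%N by [].
rewrite [leqRHS]expnS; apply: (leq_trans _ (leq_mul (leqnn 4) le_u)).
by rewrite -!mulnn; nia.
Qed.

(** [N] is the number of codes, [K] the number of possible columns and [n] stands for [u]. Zero
    columns, repeated columns and light codewords contribute at most [N / 32], [N / 4] and
    [N / 4]. *)
Lemma code_numerics (K N n X2 X3 y : R) :
  0 < K -> 0 < N -> 1 <= n -> 256%:R * n ^+ 2 <= K ->
  X2 <= 8%:R * n * (8%:R * n * (N / K)) -> y <= 4%:R^-1 -> X3 <= N * y ->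
  8%:R * n * (N / K) + X2 + X3 < N.
Proof.
move=> K_gt0 N_gt0 n1 le_K le2 le_y le3.
have r1 : n ^+ 2 / K <= 256%:R^-1.
  by rewrite (ler_pdivrMr _ _ K_gt0) ler_pdivlMl ?ltr0n.
have r2 : n / K <= 256%:R^-1.
  apply: le_trans r1; rewrite ler_wpM2r ?invr_ge0 ?(ltW K_gt0) // expr2 ler_peMl //.
  exact: le_trans n1.
have r1' := ler_wpM2l (ltW N_gt0) r1.
have r2' := ler_wpM2l (ltW N_gt0) r2.
have r3' := ler_wpM2l (ltW N_gt0) le_y.
have eX2 : 8%:R * n * (8%:R * n * (N / K)) = 64%:R * (N * (n ^+ 2 / K)) by field; rewrite gt_eqF.
have eX1 : 8%:R * n * (N / K) = 8%:R * (N * (n / K)) by field; rewrite gt_eqF.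
by rewrite eX2 in le2; rewrite eX1; lra.
Qed.

(* First moment method: a zero column, a repeated column or a light codeword each
   contribute at least 1 to [F], whose mean is below 1. *)
Lemma code_exists (d : nat) (u := (2 ^ (d - 3))%N) : (6 <= d)%N ->
  exists g : {ffun d.-tuple bool -> (2 * u).-tuple bool},
  [/\ forall a, val (g a) != nseq (2 * u) false,
      forall a a', a != a' -> g a != g a' &
      forall z, size z = (2 * u)%N -> z != nseq (2 * u) false ->
        u%:R <= \sum_a (dot z (g a))%:R :> R].
Proof.
move=> le6d; set b := (2 * u)%N.
pose D := d.-tuple bool : finType.
have cardD : #|D| = (8 * u)%N.
  rewrite card_tuple card_bool /u -[in LHS](@subnKC 3 d) ?expnD //.
  exact: (leq_trans _ le6d).
have u8 : (8 <= u)%N by rewrite /u (@leq_exp2l 2 3) //; lia.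
clearbody u; pose z0 := nseq b false.
pose F (g : {ffun D -> b.-tuple bool}) : R :=
  \sum_a (val (g a) == z0)%:R + \sum_a \sum_(a' | a' != a) (g a == g a')%:R
  + \sum_(z : b.-tuple bool | val z != z0)
      3%:R ^+ u * \prod_a (3%:R^-1) ^+ dot z (g a).
pose K : R := 2%:R ^+ b.
have [g ltF] : exists g, F g < 1.
  apply: exists_sum_lt1.
  rewrite card_ffun card_tuple card_bool !natrX -/K cardD /F !big_split /=.
  have K_gt0 : 0 < K by rewrite exprn_gt0.
  have -> : \sum_(g : {ffun D -> b.-tuple bool}) \sum_a (val (g a) == z0)%:R
      = (8 * u)%:R * (K ^+ (8 * u) / K).
    rewrite exchange_big /= (eq_bigr (fun=> K ^+ (8 * u) / K)) => [|a _].
      by rewrite sumr_const cardD mulr_natl.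
    by rewrite sum_ffun_eq ?size_nseq // cardD.
  have le2 : \sum_(g : {ffun D -> b.-tuple bool})
      \sum_a \sum_(a' | a' != a) (g a == g a')%:R
      <= (8 * u)%:R * ((8 * u)%:R * (K ^+ (8 * u) / K)).
    rewrite exchange_big /= [leRHS]mulr_natl -cardD -sumr_const.
    apply: ler_sum => a _; rewrite exchange_big /= mulr_natl -sumr_const.
    rewrite [leLHS]big_mkcond /=; apply: ler_sum => a' _; case: ifP => [ne|_].
      by rewrite sum_ffun_coll // eq_sym.
    by rewrite divr_ge0 ?exprn_ge0 // ltW.
  have le3 : \sum_(g : {ffun D -> b.-tuple bool})
      \sum_(z : b.-tuple bool | val z != z0)
        3%:R ^+ u * \prod_a (3%:R^-1) ^+ dot z (g a)
      <= K * (3%:R ^+ u * (K ^+ (8 * u) * (2%:R / 3%:R) ^+ (8 * u))).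
    have -> : K = #|{: b.-tuple bool}|%:R.
      by rewrite card_tuple card_bool natrX.
    rewrite exchange_big /= [leRHS]mulr_natl -sumr_const.
    rewrite [leLHS]big_mkcond /=; apply: ler_sum => z _.
    rewrite card_tuple card_bool natrX -/K; case: ifP => [nz|_].
      by rewrite -mulr_sumr sum_ffun_wt ?size_tuple // cardD.
    by rewrite !mulr_ge0 ?exprn_ge0 ?divr_ge0 ?ltW.
  have num : (256 * u ^ 2 <= 4 ^ u)%N.
    exact: sq_le_exp4.
  have eK : K = 4%:R ^+ u by rewrite /K /b exprM -natrX.
  (* Union bound over [K = 4 ^ u] words: [4 * 3 * (2 / 3) ^ 8 < 1 / 2], which is why [8 * u]
     coordinates suffice for weight [u]. *)
  have e3 : K * (3%:R ^+ u * (2%:R / 3%:R) ^+ (8 * u)) <= 2%:R^-1 ^+ u :> R.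
    have q : 4%:R * (3%:R * (2%:R / 3%:R) ^+ 8) <= 2%:R^-1 :> R by lra.
    have q0 : 0 <= 4%:R * (3%:R * (2%:R / 3%:R) ^+ 8) :> R by lra.
    rewrite eK [X in _ * (_ * X)]exprM -!exprMn.
    by apply: lerXn2r q; rewrite nnegrE ?invr_ge0 ?ler0n.
  have eh : 2%:R^-1 ^+ u <= 4%:R^-1 :> R.
    have h1 : (2%:R^-1 : R) ^+ (u - 8) <= 1.
      by rewrite exprn_ile1 // ?invr_ge0 ?ler0n // invf_le1 ?ltr0n // ler1n.
    have h0 : 0 <= (2%:R^-1 : R) ^+ (u - 8) by rewrite exprn_ge0 // invr_ge0 ler0n.
    by rewrite -(subnKC u8) exprD; lra.
  have numR : 256%:R * u%:R ^+ 2 <= K.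
    by rewrite eK -!natrX -natrM ler_nat.
  have u1 : 1 <= u%:R :> R by rewrite ler1n; lia.
  have Kn_gt0 : 0 < K ^+ (8 * u) by rewrite exprn_gt0.
  rewrite natrM; rewrite natrM in le2.
  apply: (code_numerics K_gt0 Kn_gt0 u1 numR le2 (le_trans e3 eh)).
  apply: (le_trans le3); rewrite le_eqVlt; apply/orP; left; apply/eqP.
  by ring.
have p1 : 0 <= \sum_a (val (g a) == z0)%:R :> R.
  by apply: sumr_ge0 => a _; exact: ler0n.
have p2 : 0 <= \sum_a \sum_(a' | a' != a) (g a == g a')%:R :> R.
  by apply: sumr_ge0 => a _; apply: sumr_ge0 => a' _; exact: ler0n.
have t3 (z : b.-tuple bool) :
    0 <= 3%:R ^+ u * \prod_a (3%:R^-1) ^+ dot z (g a) :> R.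
  by rewrite mulr_ge0 ?exprn_ge0 ?ler0n // prodr_ge0 // => a _; rewrite exprn_ge0 // invr_ge0 ler0n.
have p3 : 0 <= \sum_(z : b.-tuple bool | val z != z0)
      3%:R ^+ u * \prod_a (3%:R^-1) ^+ dot z (g a) :> R.
  by apply: sumr_ge0.
exists g; split.
- move=> a; apply: contraTN ltF => eqz; rewrite -leNgt /F (bigD1 a) //= eqz.
  have : 0 <= \sum_(i | i != a) (val (g i) == z0)%:R :> R.
    by apply: sumr_ge0 => i _; exact: ler0n.
  by rewrite /=; lra.
- move=> a a' ne; apply: contraTN ltF => eqg; rewrite -leNgt /F.
  rewrite [X in _ + X + _](bigD1 a) //= [X in _ + (X + _) + _](bigD1 a') /=; last by rewrite eq_sym.
  rewrite eqg /=.
  set S1 := (X in _ <= _ + (_ + X + _) + _); set S2 := (X in _ <= _ + (_ + X) + _).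
  have : 0 <= S1 by apply: sumr_ge0 => i _; exact: ler0n.
  have : 0 <= S2.
    by apply: sumr_ge0 => i _; apply: sumr_ge0 => j _; exact: ler0n.
  by lra.
move=> z szz nz; rewrite leNgt; apply: contraTN ltF => lt_wt; rewrite -leNgt /F.
have szz' : size z == b by apply/eqP.
rewrite (bigD1 (Tuple szz')) //=.
set S := (X in _ <= _ + (_ + X)).
have S_ge0 : 0 <= S by apply: sumr_ge0.
suff : 1 <= 3%:R ^+ u * \prod_a (3%:R^-1) ^+ dot z (g a) :> R by lra.
(* A codeword of weight at most [u] contributes 3 to the power [u] minus its weight, which is at
   least 1. *)
move: lt_wt; rewrite -natr_sum ltr_nat => /ltnW le_wt.
rewrite -expr_sum exprVn -(subnK le_wt) exprD mulfK ?expf_neq0 ?pnatr_eq0 //.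
by rewrite exprn_ege1 // ler1n.
Qed.

(** The complement bit takes one of the [d] bits of a coordinate, so the linear code has
    [2 ^ (d - 1)] columns of length [2 * 2 ^ (d - 4)]. *)
Lemma exists_pattern (d : nat) : (7 <= d)%N -> exists f, pattern (2 ^ (d - 3)) d f.
Proof.
case: d => // d le6d.
have [g [g_nz g_inj g_wt]] := code_exists le6d.
have eb : (2 * 2 ^ (d - 3) = 2 ^ (d.+1 - 3))%N.
  by rewrite -expnS subSn //; lia.
rewrite eb in g g_nz g_inj g_wt *.
pose h a := if insub a is Some a' then val (g a') else [::].
have hE (a : d.-tuple bool) : h a = g a by rewrite /h valK.
exists (code_pattern h); apply: code_patternP.
- move=> a /eqP sza; rewrite (hE (Tuple sza)) size_tuple; split=> //; exact: g_nz.
- by move=> a a' /eqP sza /eqP sza' ne; rewrite (hE (Tuple sza)) (hE (Tuple sza')) g_inj.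
move=> z szz nz; have := g_wt z szz nz.
under eq_bigr do rewrite -hE.
rewrite (sum_tuple_avg _ (fun a => (dot z (h a))%:R)).
rewrite -[in X in _ <= X * _ -> _](@subnK 3 d); last by lia.
rewrite exprD natrX -mulrA -{1}[_ ^+ _]mulr1 ler_pM2l ?exprn_gt0 ?ltr0n //.
by lra.
Qed.
End Patterns.

(** * Regular partitions of pattern graphs *)

Section ApproximateRefinement.
Variable R : realFieldType.

(** A partition is encoded by the map [pi] from points to parts; [c] guesses the label from the
    part, and a proportion [g] of wrong guesses is tolerated. *)
Definition approx_refines (X : finType) (K : Type) (pi : X -> K)
    (lam : X -> seq bool) (g : R) : Prop :=
  exists c : K -> seq bool, #|[set x | lam x != c (pi x)]|%:R <= g * #|X|%:R.

Definition edge_count (X Y : finType) (G : X -> Y -> bool)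
    (A : {set X}) (B : {set Y}) : R :=
  \sum_(x in A) \sum_(y in B) (G x y)%:R.

(* [<d>]-regularity with the denominators cleared. *)
Definition regular (d : R) (X Y : finType) (G : X -> Y -> bool)
    (A : {set X}) (B : {set Y}) : Prop :=
  forall (A' : {set X}) (B' : {set Y}), A' \subset A -> B' \subset B ->
    d * #|A|%:R <= #|A'|%:R -> d * #|B|%:R <= #|B'|%:R ->
    edge_count G A B * (#|A'|%:R * #|B'|%:R) <=
    2%:R * edge_count G A' B' * (#|A|%:R * #|B|%:R).

Lemma edge_count_ge0 (X Y : finType) (G : X -> Y -> bool) A B :
  0 <= edge_count G A B.
Proof. by apply: sumr_ge0 => x _; apply: sumr_ge0 => y _; exact: ler0n. Qed.

Lemma le_edge_count (X Y : finType) (G : X -> Y -> bool)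
    (A A' : {set X}) (B B' : {set Y}) :
  A' \subset A -> B' \subset B -> edge_count G A' B' <= edge_count G A B.
Proof.
move=> sA sB.
have le_in x : \sum_(y in B') (G x y)%:R <= \sum_(y in B) (G x y)%:R :> R.
  rewrite [leRHS](big_setID B') /= (setIidPr sB) lerDl.
  by apply: sumr_ge0 => y _; exact: ler0n.
apply: (@le_trans _ _ (edge_count G A' B)); first by apply: ler_sum.
rewrite [leRHS](big_setID A') /= (setIidPr sA) lerDl.
by apply: sumr_ge0 => x _; apply: sumr_ge0 => y _; exact: ler0n.
Qed.

Lemma edge_countT (X Y : finType) (G : X -> Y -> bool) :
  edge_count G setT setT = \sum_(p : X * Y) (G p.1 p.2)%:R.
Proof.
rewrite -(pair_bigA _ (fun x y => (G x y)%:R)) /=.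
apply: eq_big => [x|x _]; first by rewrite inE.
by apply: eq_bigl => y; rewrite inE.
Qed.

Definition fiber (X : finType) (K : eqType) (pi : X -> K) (k : K) : {set X} :=
  [set x | pi x == k].

(** In each part the point with the fewest disagreements provides the guess; its count is at most
    the average over the part. *)
Lemma approx_refines_pairs (X K : finType) (pi : X -> K) (lam : X -> seq bool) (g : R) :
  \sum_k #|fiber pi k|%:R^-1 *
    (\sum_(x in fiber pi k) \sum_(x' in fiber pi k) (lam x != lam x')%:R)
    <= g * #|X|%:R ->
  approx_refines pi lam g.
Proof.
move=> le_g.
pose bad x' := \sum_(x in fiber pi (pi x')) (lam x != lam x')%:R : R.
have ex k : exists s : seq bool, #|[set x in fiber pi k | lam x != s]|%:R <=
    #|fiber pi k|%:R^-1 *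
    (\sum_(x in fiber pi k) \sum_(x' in fiber pi k) (lam x != lam x')%:R) :> R.
  have [->|[x0 x0k]] := set_0Vmem (fiber pi k).
    by exists [::]; rewrite big_set0 mulr0 (_ : [set x in _ | _] = set0) ?cards0 //;
       apply/setP => x; rewrite !inE.
  pose F x' : R := #|[set x in fiber pi k | lam x != lam x']|%:R.
  have F0 : 0 < #|fiber pi k|%:R :> R by rewrite ltr0n; apply/card_gt0P; exists x0.
  have sumF : \sum_(x in fiber pi k) \sum_(x' in fiber pi k) (lam x != lam x')%:R
     = \sum_(x' in fiber pi k) F x'.
    rewrite exchange_big /=; apply: eq_bigr => x' _.
    rewrite /F -sum1_card natr_sum [LHS]big_mkcond [RHS]big_mkcond /=.
    by apply: eq_bigr => x _; rewrite !inE; case: (_ == k); case: (_ != _).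
  have [x' x'k minx'] : exists2 x', x' \in fiber pi k &
      forall x, x \in fiber pi k -> F x' <= F x.
    case: (arg_minP F x0k) => x' x'k minx'.
    by exists x'.
  exists (lam x'); rewrite mulrC ler_pdivlMr // sumF mulrC mulr_natl -sumr_const.
  by apply: ler_sum => x /minx'.
have [c cP] := fin_all_exists ex.
exists c; apply: le_trans le_g.
rewrite -sum1_card natr_sum (partition_big pi predT) //=.
apply: ler_sum => k _; apply: le_trans (cP k).
rewrite -sum1_card natr_sum le_eqVlt; apply/orP; left; apply/eqP.
by apply: eq_bigl => x; rewrite !inE andbC; case: eqP => // ->.
Qed.

(** [D] counts the edits on [A * Q0], [eG] the edges of the original graph there, [eG'] and [eG0]
    the edges of the edited graph on [A * Q] and [A0 * Q0]. The original graph is empty on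
    [A0 * Q0], hence [eG0 <= D], and regularity bounds [eG'] by [eG0]. *)
Lemma regular_pair_arith (A A0 Q Q0 d D eG eG0 eG' : R) :
  0 < d -> Q <= 2%:R * Q0 -> 0 < Q0 -> eG0 <= D -> eG <= eG' + D -> A0 <= A ->
  0 <= A0 -> 0 <= D -> 0 <= eG -> 0 <= eG' -> 0 <= eG0 ->
  eG' * (A0 * Q0) <= 2%:R * eG0 * (A * Q) ->
  A0 * eG <= A * (5%:R * D + d * eG).
Proof.
move=> d_gt0 leQ Q0_gt0 le_add le_rem le_A0 A0_ge0 D_ge0 e_ge0 e1 e2 h.
have h1 : eG' * A0 <= 4%:R * eG0 * A.
  rewrite -(ler_pM2r Q0_gt0); apply: le_trans (_ : 2%:R * eG0 * (A * Q) <= _).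
    by move: h; rewrite mulrA.
  have A_ge0 : 0 <= A by exact: le_trans le_A0.
  have := ler_wpM2l (mulr_ge0 e2 A_ge0) leQ; lra.
have h2 := ler_wpM2l A0_ge0 le_rem.
have A_ge0 : 0 <= A by exact: le_trans le_A0.
have h3 := ler_wpM2r D_ge0 le_A0.
have h4 := ler_wpM2r A_ge0 le_add.
have h5 : 0 <= A * (d * eG) by rewrite !mulr_ge0 // ltW.
by lra.
Qed.

Section RegularityInequality.
Variables (X Y KX KY : finType) (piX : X -> KX) (piY : Y -> KY).
Variables (G G' : X -> Y -> bool) (d : R).
Hypotheses (d_gt0 : 0 < d) (le_d : d <= 2%:R^-1).
Hypothesis reg : forall x0 y0,
  regular d G' (fiber piX (piX x0)) (fiber piY (piY y0)).
Variables (Bad : {set Y}) (z : KY -> X -> bool).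
Hypothesis z_nonadj : forall x y, y \notin Bad -> z (piY y) x -> ~~ G x y.
Hypothesis large_good : forall k, fiber piY k :\: Bad != set0 ->
  (#|fiber piY k| <= 2 * #|fiber piY k :\: Bad|)%N.

Let D x y := G x y != G' x y.

(** If the points without neighbours make up less than a proportion [d] of the part, the term
    [d * eG] suffices. Otherwise they form an admissible test set for regularity, against the good
    half of the cell, which is large enough as [d <= 1 / 2]. *)
Lemma regular_pair_bound a k :
  (#|[set x in fiber piX a | z k x]|%:R * edge_count G (fiber piX a) (fiber piY k :\: Bad)
   <= #|fiber piX a|%:R * (5%:R * edge_count D (fiber piX a) (fiber piY k :\: Bad)
       + d * edge_count G (fiber piX a) (fiber piY k :\: Bad))).
Proof.
set A := fiber piX a; set Q := fiber piY k; set Q0 := Q :\: Bad.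
set A0 := [set x in A | z k x].
have sA0 : A0 \subset A by apply/subsetP => x; rewrite inE => /andP[].
have sQ0 : Q0 \subset Q by rewrite subsetDl.
have [Q0_0|Q0_n0] := eqVneq Q0 set0.
  rewrite Q0_0 /edge_count.
  have e0 H : \sum_(x in A) \sum_(y in set0 : {set Y}) (H x y : bool)%:R = 0 :> R.
    by rewrite big1 // => x _; rewrite big_set0.
  by rewrite !e0 !mulr0 addr0 mulr0.
have [A_0|[x0 x0A]] := set_0Vmem A.
  have -> : A0 = set0 by apply/eqP; rewrite -subset0 -A_0.
  by rewrite A_0 !cards0 !mul0r.
have [y0 y0Q0] := set0Pn _ Q0_n0.
have e_ge0 := edge_count_ge0 G A Q0.
have D_ge0 := edge_count_ge0 D A Q0.
have [lt_A0|ge_A0] := ltrP (#|A0|%:R) (d * #|A|%:R).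
  apply: le_trans (ler_wpM2r e_ge0 (ltW lt_A0)) _.
  rewrite mulrDr -mulrA mulrCA [leRHS]addrC lerDl.
  by rewrite !mulr_ge0 ?ler0n.
have eqa : piX x0 = a by move: x0A; rewrite inE => /eqP.
have eqk : piY y0 = k by move: y0Q0; rewrite !inE => /andP[_ /eqP].
have leQ : #|Q|%:R <= 2%:R * #|Q0|%:R :> R by rewrite -natrM ler_nat; exact: large_good.
have Q0_gt0 : 0 < #|Q0|%:R :> R by rewrite ltr0n; apply/card_gt0P; exists y0.
have dQ : d * #|Q|%:R <= #|Q0|%:R.
  have := ler_wpM2r (ler0n R #|Q|) le_d; lra.
have := @reg x0 y0 A0 Q0; rewrite eqa eqk => /(_ sA0 sQ0 ge_A0 dQ).
rewrite -/A -/Q.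
have le_add : edge_count G' A0 Q0 <= edge_count D A Q0.
  apply: (@le_trans _ _ (edge_count D A0 Q0)); last exact: le_edge_count.
  apply: ler_sum => x; rewrite inE => /andP[_ zx]; apply: ler_sum => y yQ0.
  have /negPf nG : ~~ G x y.
    move: yQ0; rewrite !inE => /andP[nb /eqP eqy].
    by apply: z_nonadj; rewrite ?eqy.
  by rewrite /D nG; case: (G' x y).
have le_rem : edge_count G A Q0 <= edge_count G' A Q + edge_count D A Q0.
  apply: (@le_trans _ _ (edge_count G' A Q0 + edge_count D A Q0)).
    rewrite -big_split /=; apply: ler_sum => x _.
    rewrite -big_split /=; apply: ler_sum => y _.
    by rewrite /D -natrD ler_nat; case: (G x y); case: (G' x y).
  by rewrite lerD2r le_edge_count.
have le_A0 : #|A0|%:R <= #|A|%:R :> R by rewrite ler_nat subset_leq_card.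
have A0_ge0 : 0 <= #|A0|%:R :> R by exact: ler0n.
move: (edge_count_ge0 G' A Q) (edge_count_ge0 G' A0 Q0).
move: leQ Q0_gt0 le_add le_rem le_A0 A0_ge0 D_ge0 e_ge0.
move: (edge_count D A Q0) (edge_count G A Q0) (edge_count G' A0 Q0) (edge_count G' A Q).
move: #|A|%:R #|A0|%:R #|Q|%:R #|Q0|%:R d_gt0.
move=> A1 A2 Q1 Q2 d_gt0' D1 e1 e2 e3 *.
exact: (@regular_pair_arith _ _ Q1 Q2 d D1 e1 e2 e3).
Qed.

(** [regular_pair_bound] is divided by the size of the part of [X] and summed; the pairs of cells
    are disjoint, so edges and edits add up to at most their totals. *)
Lemma regularity_inequality :
  \sum_a #|fiber piX a|%:R^-1 *
    (\sum_(x in fiber piX a) \sum_(x' in fiber piX a)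
      \sum_(y in ~: Bad) (z (piY y) x' && G x y)%:R)
  <= 5%:R * edge_count D setT setT + d * edge_count G setT setT.
Proof.
have part_good a (F : X -> Y -> R) :
    \sum_(x in fiber piX a) \sum_(y in ~: Bad) F x y =
    \sum_k \sum_(x in fiber piX a) \sum_(y in fiber piY k :\: Bad) F x y.
  rewrite [RHS]exchange_big /=; apply: eq_bigr => x _.
  rewrite (partition_big piY predT) //=; apply: eq_bigr => k _.
  by apply: eq_bigl => y; rewrite !inE.
have split_edges H :
    \sum_a \sum_k edge_count H (fiber piX a) (fiber piY k :\: Bad)
    <= edge_count H setT setT.
  rewrite (@le_trans _ _ (edge_count H setT (~: Bad))) ?le_edge_count ?subsetT //.
  rewrite /edge_count [leRHS](eq_bigl predT) => [|x]; last by rewrite inE.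
  rewrite (partition_big piX predT) //=; apply: ler_sum => a _.
  rewrite -part_good le_eqVlt; apply/orP; left; apply/eqP.
  by apply: eq_bigl => x; rewrite inE.
apply: (@le_trans _ _ (\sum_a \sum_k
   (5%:R * edge_count D (fiber piX a) (fiber piY k :\: Bad)
       + d * edge_count G (fiber piX a) (fiber piY k :\: Bad)))).
  apply: ler_sum => a _.
  have -> : \sum_(x in fiber piX a) \sum_(x' in fiber piX a)
      \sum_(y in ~: Bad) (z (piY y) x' && G x y)%:R =
      \sum_k #|[set x in fiber piX a | z k x]|%:R *
        edge_count G (fiber piX a) (fiber piY k :\: Bad).
    rewrite exchange_big /=.
    under eq_bigr do rewrite (part_good _ (fun x y => (z (piY y) _ && G x y)%:R)).
    rewrite exchange_big /=; apply: eq_bigr => k _.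
    rewrite -sum1_card natr_sum mulr_suml [RHS]big_mkcond [LHS]big_mkcond /=.
    apply: eq_bigr => x' _; rewrite !inE; case: (_ == a) => //=.
    case zk: (z k x').
      rewrite mul1r; apply: eq_bigr => x _; apply: eq_bigr => y.
      by rewrite !inE => /andP[_ /eqP->]; rewrite zk.
    rewrite big1 // => x _; rewrite big1 // => y.
    by rewrite !inE => /andP[_ /eqP->]; rewrite zk.
  rewrite mulr_sumr; apply: ler_sum => k _.
  have [->|[x xA]] := set_0Vmem (fiber piX a).
    rewrite cards0 invr0 mul0r addr_ge0 ?mulr_ge0 ?edge_count_ge0 ?ler0n //.
    exact: ltW.
  rewrite ler_pdivrMl ?regular_pair_bound //.
  by rewrite ltr0n; apply/card_gt0P; exists x.
under eq_bigr do rewrite big_split -!mulr_sumr /=.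
rewrite big_split -!mulr_sumr /= lerD // ler_wpM2l ?ler0n //.
exact: ltW.
Qed.
End RegularityInequality.
End ApproximateRefinement.

(** * Pattern graphs: separation, second moments, forced refinement *)

Section Core.
Variable R : realFieldType.

Definition equidistributed (X : finType) (h : X -> seq bool) (N : nat) : Prop :=
  (forall x, size (h x) = N) /\
  forall F : seq bool -> R, \sum_x F (h x) = #|X|%:R * avg N F.

Lemma natr_forall (T : nat) (P : 'I_T -> bool) :
  [forall t, P t]%:R = \prod_t (P t)%:R :> R.
Proof.
case: forallP => [allP|nP] /=.
  by rewrite big1 // => t _; rewrite allP.
have /existsP[t /negPf Pt] : [exists t, ~~ P t].
  by rewrite -negb_forall; apply/forallP.
by rewrite (bigD1 t) //= Pt mul0r.
Qed.

Variables (X Y : finType) (h : X -> seq bool) (rho : Y -> seq bool) (N M : nat).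
Variables (bs ds : nat -> nat) (f : nat -> seq bool -> seq bool -> bool) (T : nat).
Hypotheses (h_eq : equidistributed h N) (rho_eq : equidistributed rho M).
Hypothesis pat : forall t, (t < T)%N -> pattern R (bs t) (ds t) (f t).
Hypotheses (le_bs : (offset bs T <= N)%N) (le_ds : (offset ds T <= M)%N).

Definition pattern_bit (t : nat) (x : X) (y : Y) : bool :=
  f t (block bs t (h x)) (block ds t (rho y)).

Lemma size_blockX t x : (t < T)%N -> size (block bs t (h x)) = bs t.
Proof.
move=> ltT; rewrite size_block // h_eq.1 (leq_trans _ le_bs) //.
exact: offset_mono.
Qed.

Lemma size_blockY t y : (t < T)%N -> size (block ds t (rho y)) = ds t.
Proof.
move=> ltT; rewrite size_block // rho_eq.1 (leq_trans _ le_ds) //.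
exact: offset_mono.
Qed.

Lemma sum_blocksX (phi : nat -> seq bool -> R) :
  \sum_x \prod_(t < T) phi t (block bs t (h x)) =
  #|X|%:R * \prod_(t < T) avg (bs t) (phi t).
Proof.
by rewrite (h_eq.2 (fun s => \prod_(t < T) phi t (block bs t s))) avg_blocks.
Qed.

Lemma sum_blocksY (phi : nat -> seq bool -> R) :
  \sum_y \prod_(t < T) phi t (block ds t (rho y)) =
  #|Y|%:R * \prod_(t < T) avg (ds t) (phi t).
Proof.
by rewrite (rho_eq.2 (fun s => \prod_(t < T) phi t (block ds t s))) avg_blocks.
Qed.

Lemma avg_eq_half n (u : seq bool -> bool) (e : bool) :
  avg n (fun s => (u s)%:R) = 2%:R^-1 :> R ->
  avg n (fun s => (u s == e)%:R) = 2%:R^-1 :> R.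
Proof.
move=> avg_u; rewrite -avg_u; case: e.
  by apply: eq_avg => s _; case: (u s).
rewrite (@eq_avg _ _ _ (fun s => 1 + (-1) * (u s)%:R)) => [|s _].
  by rewrite avgD avgZ avg_const avg_u; lra.
by case: (u s) => /=; lra.
Qed.

(** Already for fixed [x] the bits are independent and fair: rows are balanced and read distinct
    blocks of [rho y]. *)
Lemma equidistributed_bits :
  equidistributed
    (fun p : X * Y => mkseq (fun t => pattern_bit t p.1 p.2) T) T.
Proof.
split=> [p|F]; first by rewrite size_mkseq.
rewrite -(pair_bigA _ (fun x y => F (mkseq (fun t => pattern_bit t x y) T))) /=.
rewrite (eq_bigr (fun=> #|Y|%:R * avg T F)) => [|x _].
  by rewrite sumr_const card_prod natrM -[LHS]mulr_natl mulrA.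
rewrite (rho_eq.2 (fun s => F (mkseq
  (fun t => f t (block bs t (h x)) (block ds t s)) T))).
congr (_ * _); apply: (avg_bits_blocks (g := fun t => f t (block bs t (h x)))) => // t ltT.
by rewrite (pattern_row (pat ltT)) // size_blockX.
Qed.

Section Bits.
Variable eps : nat -> bool.

Definition pattern_graph (x : X) (y : Y) : bool :=
  [forall t : 'I_T, pattern_bit t x y == eps t].

Local Notation G := pattern_graph.

Lemma pattern_graph_degree x : \sum_y (G x y)%:R = #|Y|%:R / 2%:R ^+ T :> R.
Proof.
under eq_bigr do rewrite natr_forall.
rewrite (sum_blocksY (fun t a => (f t (block bs t (h x)) a == eps t)%:R)).
congr (_ * _); rewrite -exprVn -[in RHS](card_ord T) -prodr_const.
apply: eq_bigr => t _; apply: avg_eq_half.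
by rewrite (pattern_row (pat (ltn_ord t))) // size_blockX.
Qed.

Lemma pattern_graph_size :
  edge_count R G setT setT = #|X|%:R * #|Y|%:R / 2%:R ^+ T.
Proof.
rewrite /edge_count (eq_bigr (fun=> #|Y|%:R / 2%:R ^+ T)) => [|x _].
  by rewrite sumr_const cardsT -[LHS]mulr_natl mulrA.
rewrite -(pattern_graph_degree x); apply: eq_bigl => y.
by rewrite inE.
Qed.

(** The two codewords differ on 1/8 of the coordinates. Both are balanced, so on half of these, a
    proportion of 1/16, it is [x] that agrees with [eps]; the other [T - 1] bits agree
    independently. *)
Lemma pattern_graph_separation x x' t : (t < T)%N ->
  block bs t (h x) != block bs t (h x') ->
  #|Y|%:R / 2%:R ^+ T / 8%:R <=
  \sum_y (G x y && (pattern_bit t x' y != eps t))%:R :> R.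
Proof.
move=> ltT ne.
pose u := block bs t (h x); pose u' := block bs t (h x').
pose phi i a : R := if i == t then ((f t u a == eps t) && (f t u' a != eps t))%:R
  else (f i (block bs i (h x)) a == eps i)%:R.
have -> : \sum_y (G x y && (pattern_bit t x' y != eps t))%:R =
    \sum_y \prod_(i < T) phi i (block ds i (rho y)).
  apply: eq_bigr => y _; rewrite -mulnb natrM natr_forall.
  rewrite (bigD1 (Ordinal ltT)) //= [RHS](bigD1 (Ordinal ltT)) //= /phi eqxx.
  rewrite mulrAC -natrM mulnb; congr (_ * _).
  by apply: eq_bigr => i ne_i; rewrite -val_eqE /= in ne_i; rewrite (negPf ne_i).
rewrite sum_blocksY -!mulrA ler_wpM2l ?ler0n //.
rewrite (bigD1 (Ordinal ltT)) //= /phi eqxx.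
have szu : size u = bs t by rewrite size_blockX.
have szu' : size u' = bs t by rewrite size_blockX.
have Pt := pat ltT.
have sep := pattern_sep Pt szu szu' ne.
have e1 := avg_eq_half (eps t) (pattern_row Pt szu).
have e2 := avg_eq_half (eps t) (pattern_row Pt szu').
set p := avg _ (fun a => ((f t u a == _) && _)%:R).
set q := avg (ds t) (fun a => ((f t u a == eps t) && (f t u' a == eps t))%:R) : R.
set r := avg (ds t) (fun a => ((f t u a != eps t) && (f t u' a == eps t))%:R) : R.
have e3 : p + q = 2%:R^-1.
  rewrite -e1 -avgD; apply: eq_avg => a _.
  by rewrite -natrD; congr (_%:R); do 2!case: (_ == _).
have e4 : r + q = 2%:R^-1.
  rewrite -e2 -avgD; apply: eq_avg => a _.
  by rewrite -natrD; congr (_%:R); do 2!case: (_ == _).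
have e5 : avg (ds t) (fun a => (f t u a != f t u' a)%:R) = p + r :> R.
  rewrite -avgD; apply: eq_avg => a _; rewrite -natrD; congr (_%:R).
  by case: (eps t); case: (f t u a); case: (f t u' a).
have lep : 16%:R^-1 <= p by rewrite e5 in sep; lra.
rewrite (eq_bigr (fun=> 2%:R^-1)) => [|i ne_i]; last first.
  rewrite -val_eqE /= in ne_i; rewrite (negPf ne_i); apply: avg_eq_half.
  by rewrite (pattern_row (pat (ltn_ord i))) // size_blockX.
rewrite prodr_const cardC1 card_ord.
have half_ge0 : 0 <= (2%:R^-1 : R) ^+ T.-1 by rewrite exprn_ge0 // invr_ge0 ler0n.
rewrite -exprVn -{1}(ltn_predK ltT) exprS.
have := ler_wpM2r half_ge0 lep; lra.
Qed.

(* The first pattern is dropped: its block of [rho] is too short for a useful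
   second moment bound, and dropping it only loses a factor of 2. *)
Definition late_graph (x : X) (y : Y) : bool :=
  [forall t : 'I_T, (val t == 0%N) || (pattern_bit t x y == eps t)].

Definition late_density : R :=
  \prod_(t < T) (if val t == 0%N then 1 else 2%:R^-1).

(** Excess of the mean of [same_blocks] over 1, which bounds the relative variance. *)
Definition deviation : R :=
  \prod_(t < T) (if val t == 0%N then 1 else 1 + (2%:R ^+ ds t)^-1) - 1.

Lemma late_density_gt0 : 0 < late_density.
Proof.
by apply: prodr_gt0 => t _; case: ifP => _; rewrite ?ltr01 // invr_gt0 ltr0n.
Qed.

Lemma late_densityE : (0 < T)%N -> late_density = 2%:R / 2%:R ^+ T.
Proof.
move=> T_gt0; rewrite /late_density (bigD1 (Ordinal T_gt0)) //= mul1r.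
rewrite (eq_bigr (fun=> 2%:R^-1)) => [|i ne_i]; last first.
  by rewrite -val_eqE /= in ne_i; rewrite (negPf ne_i).
rewrite prodr_const cardC1 card_ord -[X in _ / _ ^+ X](ltn_predK T_gt0) exprVn exprS.
by rewrite invfM mulrA divff ?mul1r // pnatr_eq0.
Qed.

Lemma late_first_moment y : \sum_x (late_graph x y)%:R = #|X|%:R * late_density.
Proof.
under eq_bigr do rewrite natr_forall.
rewrite (sum_blocksX (fun t s =>
  ((t == 0%N) || (f t s (block ds t (rho y)) == eps t))%:R)).
congr (_ * _); apply: eq_bigr => t _; case: eqP => [_|_] /=.
  by rewrite avg_const.
apply: avg_eq_half.
by rewrite (pattern_col (pat (ltn_ord t))) // size_blockY.
Qed.

(** Bound for the codegree of [y] and [y'] relative to independence: each common block doubles it,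
    and pairwise independence makes distinct blocks harmless. *)
Definition same_blocks (y y' : Y) : R :=
  \prod_(t < T) (if val t == 0%N then 1
    else 1 + (block ds t (rho y) == block ds t (rho y'))%:R).

Lemma same_blocks_ge1 y y' : 1 <= same_blocks y y'.
Proof.
rewrite /same_blocks; elim/big_ind: _ => // [a b a1 b1|t _].
  by rewrite (le_trans a1) // ler_peMr // (le_trans _ a1).
by case: ifP => // _; rewrite lerDl ler0n.
Qed.

Lemma late_second_moment y y' :
  \sum_x (late_graph x y && late_graph x y')%:R <=
  #|X|%:R * (late_density ^+ 2 * same_blocks y y').
Proof.
pose phi t s : R := ((t == 0%N) || ((f t s (block ds t (rho y)) == eps t)
   && (f t s (block ds t (rho y')) == eps t)))%:R.
have -> : \sum_x (late_graph x y && late_graph x y')%:R =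
    \sum_x \prod_(t < T) phi t (block bs t (h x)).
  apply: eq_bigr => x _; rewrite -mulnb natrM !natr_forall -big_split /=.
  apply: eq_bigr => t _; rewrite -natrM mulnb /phi /pattern_bit.
  by case: (val t == 0%N).
rewrite sum_blocksX ler_wpM2l ?ler0n //.
rewrite /late_density /same_blocks expr2 -!big_split /=.
apply: ler_prod => t _; apply/andP; split.
  rewrite -(avg_const (bs t) (0 : R)); apply: le_avg => s _; exact: ler0n.
rewrite /phi; case: (val t == 0%N) => /=; first by rewrite avg_const !mul1r.
case: eqP => [eqb|/eqP ne] /=.
  rewrite (_ : _ * _ = 2%:R^-1); last by lra.
  rewrite le_eqVlt; apply/orP; left; apply/eqP.
  rewrite eqb; under eq_avg do rewrite andbb.
  apply: avg_eq_half.
  by rewrite (pattern_col (pat (ltn_ord t))) // size_blockY.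
rewrite (_ : _ * _ = 4%:R^-1); last by lra.
by apply: (pattern_pair (pat (ltn_ord t))); rewrite ?size_blockY.
Qed.

Lemma sum_same_blocks y : \sum_y' same_blocks y y' = #|Y|%:R * (1 + deviation).
Proof.
rewrite /deviation addrC subrK /same_blocks.
rewrite (sum_blocksY (fun t a => if t == 0%N then 1
    else 1 + (block ds t (rho y) == a)%:R)).
congr (_ * _); apply: eq_bigr => t _; case: ifP => _; first by rewrite avg_const.
rewrite avgD avg_const; congr (_ + _).
under eq_avg do rewrite eq_sym.
by rewrite avg_eq size_blockY // eqxx mul1r.
Qed.

(** Chebyshev's inequality: the mean degree into [B] is at most [#|Y| * late_density / 64], so
    exceeding twice this is a deviation of that size, and 4096 is the square of 64. *)
Lemma deviation_bound (B : {set Y}) : (0 < #|Y|)%N ->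
  #|B|%:R <= #|Y|%:R / 64%:R :> R ->
  #|[set x | #|Y|%:R * late_density / 32%:R < \sum_(y in B) (late_graph x y)%:R]|%:R
  <= 4096%:R * deviation * #|X|%:R.
Proof.
move=> Y_gt0 leB.
set S := fun x => \sum_(y in B) (late_graph x y)%:R : R.
set bad := [set x | _].
set q := late_density; pose n : R := #|Y|%:R; pose mu := q * #|B|%:R.
have q_gt0 : 0 < q := late_density_gt0.
have n_gt0 : 0 < n by rewrite ltr0n.
have sumS : \sum_x S x = #|X|%:R * mu.
  rewrite exchange_big /= (eq_bigr (fun=> #|X|%:R * q)) => [|y _].
    by rewrite sumr_const -[LHS]mulr_natr mulrA.
  exact: late_first_moment.
have sumS2 : \sum_x S x ^+ 2 <= #|X|%:R * (q ^+ 2 * (#|B|%:R ^+ 2 + n ^+ 2 * deviation)).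
  have -> : \sum_x S x ^+ 2 =
      \sum_(y in B) \sum_(y' in B) \sum_x (late_graph x y && late_graph x y')%:R.
    transitivity (\sum_x \sum_(y in B) \sum_(y' in B)
        (late_graph x y && late_graph x y')%:R : R).
      apply: eq_bigr => x _; rewrite expr2 mulr_suml; apply: eq_bigr => y _.
      rewrite mulr_sumr; apply: eq_bigr => y' _.
      by rewrite -natrM mulnb.
    by rewrite exchange_big /=; apply: eq_bigr => y _; rewrite exchange_big.
  apply: (@le_trans _ _ (\sum_(y in B) \sum_(y' in B)
      #|X|%:R * (q ^+ 2 * same_blocks y y'))).
    by apply: ler_sum => y _; apply: ler_sum => y' _; exact: late_second_moment.
  under eq_bigr do rewrite -!mulr_sumr.
  rewrite -!mulr_sumr ler_wpM2l ?ler0n // ler_wpM2l ?sqr_ge0 //.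
  have -> : \sum_(y in B) \sum_(y' in B) same_blocks y y' =
      #|B|%:R ^+ 2 + \sum_(y in B) \sum_(y' in B) (same_blocks y y' - 1).
    rewrite expr2 [#|B|%:R * _]mulr_natl -sumr_const -big_split /=.
    apply: eq_bigr => y _; rewrite -[in RHS]sumr_const -big_split /=.
    by apply: eq_bigr => y' _; rewrite addrC subrK.
  rewrite lerD2l.
  (* The excesses are nonnegative, so the unknown set [B] can be enlarged to all of [Y]. *)
  apply: (@le_trans _ _ (\sum_(y : Y) \sum_(y' : Y) (same_blocks y y' - 1))).
    rewrite [leLHS]big_mkcond /=; apply: ler_sum => y _; case: ifP => _; last first.
      by apply: sumr_ge0 => y' _; rewrite subr_ge0 same_blocks_ge1.
    rewrite [leLHS]big_mkcond /=; apply: ler_sum => y' _; case: ifP => // _.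
    by rewrite subr_ge0 same_blocks_ge1.
  rewrite (eq_bigr (fun=> n * deviation)) => [|y _].
    by rewrite sumr_const -[leLHS]mulr_natl mulrA expr2.
  rewrite sumrB sum_same_blocks sumr_const -/n.
  by rewrite mulrDr mulr1 addrC addKr.
have var : \sum_x (S x - mu) ^+ 2 <= #|X|%:R * (q ^+ 2 * (n ^+ 2 * deviation)).
  have -> : \sum_x (S x - mu) ^+ 2 =
      \sum_x S x ^+ 2 - 2%:R * mu * \sum_x S x + #|X|%:R * mu ^+ 2.
    have -> : #|X|%:R * mu ^+ 2 = \sum_(x : X) mu ^+ 2 by rewrite sumr_const mulr_natl.
    rewrite mulr_sumr -sumrB -big_split /=.
    by apply: eq_bigr => x _; rewrite sqrrB; ring.
  rewrite sumS; move: sumS2; rewrite /mu; lra.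
have dev x : x \in bad -> (q * n / 64%:R) ^+ 2 <= (S x - mu) ^+ 2.
  rewrite inE => lt_S.
  have leM : mu <= q * n / 64%:R.
    have := ler_wpM2l (ltW q_gt0) leB; rewrite /mu -/n; lra.
  have h0 : 0 <= q * n / 64%:R by rewrite !mulr_ge0 ?invr_ge0 ?ler0n // ltW.
  apply: lerXn2r; rewrite ?nnegrE //; move: lt_S; rewrite -/(S x) -/n -/q; lra.
have le_bad : #|bad|%:R * (q * n / 64%:R) ^+ 2 <= \sum_x (S x - mu) ^+ 2.
  rewrite mulr_natl -sumr_const [leLHS]big_mkcond /=; apply: ler_sum => x _.
  by case: ifP => [/dev //|_]; exact: sqr_ge0.
have qn_gt0 : 0 < (q * n / 64%:R) ^+ 2.
  by rewrite exprn_gt0 // !mulr_gt0 // invr_gt0 ltr0n.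
rewrite -(ler_pM2r qn_gt0); apply: le_trans le_bad _; apply: le_trans var _.
rewrite le_eqVlt; apply/orP; left; apply/eqP.
by field.
Qed.

Section Refinement.
Variables (KX KY : finType) (piX : X -> KX) (piY : Y -> KY).
Variables (G' : X -> Y -> bool) (d : R) (t : nat).
Hypotheses (Y_gt0 : (0 < #|Y|)%N) (lt_tT : (t < T)%N).
Hypotheses (d_gt0 : 0 < d) (le_d : d <= 2%:R^-1).
Hypothesis reg : forall x0 y0,
  regular d G' (fiber piX (piX x0)) (fiber piY (piY y0)).
Hypothesis few_edits : edge_count R (fun x y => G x y != G' x y) setT setT
  <= d * edge_count R G setT setT.
Hypothesis refY : approx_refines piY
  (fun y => take (offset ds t.+1) (rho y)) (128%:R^-1 : R).

(* Parts of [piY] with at least half their mass outside their main cell are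
   declared bad altogether; on the others the regularity test runs inside the cell. *)
Lemma regular_graph_refines :
  approx_refines piX (fun x => take (offset bs t.+1) (h x))
    (96%:R * d + 4096%:R * deviation).
Proof.
have [c cP] := refY.
set B0 := [set y | _] in cP.
pose bad k := (2 * #|fiber piY k :\: B0| < #|fiber piY k|)%N.
pose Bad := B0 :|: [set y | bad (piY y)].
pose z k x := ~~ [forall i : 'I_t.+1,
  f i (block bs i (h x)) (block ds i (c k)) == eps i].
have zE y x : y \notin Bad ->
    z (piY y) x = ~~ [forall i : 'I_t.+1, pattern_bit i x y == eps i].
  rewrite /z !inE negb_or negbK => /andP[/eqP <- _].
  by congr (~~ _); apply: eq_forallb => i; rewrite block_take.
have z_nonadj x y : y \notin Bad -> z (piY y) x -> ~~ G x y.
  move=> nBad; rewrite zE //; apply: contra => /forallP allG.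
  apply/forallP => i; have lti : (i < T)%N by apply: leq_trans lt_tT; exact: ltn_ord.
  exact: (allG (Ordinal lti)).
have fiberD k : fiber piY k :\: Bad = if bad k then set0 else fiber piY k :\: B0.
  apply/setP => y; rewrite !inE; case: ifP => bk; rewrite ?inE.
    by rewrite andbC; case: eqP => // ->; rewrite bk orbT.
  by rewrite ![_ && (_ == k)]andbC; case: eqP => // ->; rewrite bk orbF.
have large_good k : fiber piY k :\: Bad != set0 ->
    (#|fiber piY k| <= 2 * #|fiber piY k :\: Bad|)%N.
  by rewrite fiberD /bad; case: ltnP => //; rewrite eqxx.
(* A bad part has more than half of its points in [B0], so [Bad] is at most twice as large as
   [B0]. *)
have leBad : #|Bad|%:R <= #|Y|%:R / 64%:R :> R.
  have : (#|Bad| <= 2 * #|B0|)%N.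
    have card_fibers (B : {set Y}) : #|B| = (\sum_k #|fiber piY k :&: B|)%N.
      rewrite -sum1_card (partition_big piY predT) //=; apply: eq_bigr => k _.
      by rewrite -sum1_card; apply: eq_bigl => y; rewrite !inE andbC.
    rewrite (card_fibers Bad) (card_fibers B0) big_distrr /=; apply: leq_sum => k _.
    have e1 := cardsID Bad (fiber piY k); have e2 := cardsID B0 (fiber piY k).
    rewrite fiberD /bad in e1; move: e1; case: ltnP => [lt_k|_] e1.
      by rewrite cards0 in e1; lia.
    by lia.
  rewrite -(ler_nat R) natrM; move: cP; lra.
have D1 := deviation_bound Y_gt0 leBad.
set far := [set x | _] in D1.
set q : R := #|Y|%:R / 2%:R ^+ T.
have q_gt0 : 0 < q by rewrite divr_gt0 ?exprn_gt0 ?ltr0n.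
have T_gt0 : (0 < T)%N by exact: leq_ltn_trans lt_tT.
(* Separation yields [q / 8] witnesses; for [x] outside [far] at most [q / 16] of them are lost in
   [Bad]. *)
have sep x x' : x \notin far ->
    take (offset bs t.+1) (h x) != take (offset bs t.+1) (h x') ->
    q / 16%:R <= \sum_(y in ~: Bad) (z (piY y) x' && G x y)%:R :> R.
  rewrite inE -leNgt late_densityE // => le_far ne.
  have [i lt_it ne_i] : exists2 i, (i < t.+1)%N &
      block bs i (h x) != block bs i (h x').
    have /existsP[i ne_i] : [exists i : 'I_t.+1, block bs i (h x) != block bs i (h x')].
      apply: contraR ne; rewrite negb_exists => /forallP eqb.
      have le_o y : (offset bs t.+1 <= size (h y))%N.
        rewrite h_eq.1; apply: leq_trans le_bs; exact: offset_mono.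
      rewrite (@eq_take_blocks bs t.+1 (h x) (h x')) // => i lti.
      by have := eqb (Ordinal lti); rewrite negbK => /eqP.
    by exists i.
  have lt_iT : (i < T)%N by exact: leq_trans lt_tT.
  have := pattern_graph_separation lt_iT ne_i.
  rewrite (bigID [in Bad]) /= -/q => le_q.
  have le1 : \sum_(y in Bad) (G x y && (pattern_bit i x' y != eps i))%:R <=
      \sum_(y in Bad) (late_graph x y)%:R :> R.
    apply: ler_sum => y _; rewrite ler_nat; case: andP => // -[/forallP allG _].
    rewrite lt0b; apply/forallP => j; by rewrite allG orbT.
  have le2 : \sum_(y | y \notin Bad) (G x y && (pattern_bit i x' y != eps i))%:R <=
      \sum_(y in ~: Bad) (z (piY y) x' && G x y)%:R :> R.
    rewrite [leRHS](eq_bigl [pred y | y \notin Bad]) => [|y]; last by rewrite !inE.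
    apply: ler_sum => y nB; rewrite ler_nat zE //; case: (G x y) => //=.
    case: eqP => //= ne_y; rewrite andbT lt0b.
    apply/forallP => allE; apply: ne_y; exact: (eqP (allE (Ordinal lt_it))).
  have e : #|Y|%:R * (2%:R / 2%:R ^+ T) / 32%:R = q / 16%:R.
    by rewrite /q; field; rewrite expf_neq0 // pnatr_eq0.
  move: le_far le_q le1 le2; rewrite e.
  set a := \sum_(y in Bad) _; set b := \sum_(y in Bad) _.
  set u := \sum_(y in ~: Bad) _; set v := \sum_(y | _) _.
  lra.
apply: approx_refines_pairs.
set pairs := (X in X <= _).
have ineq := regularity_inequality d_gt0 le_d reg z_nonadj large_good.
have low : q / 16%:R * pairs <= q / 16%:R * #|far|%:R +
   (5%:R * edge_count R (fun x y => G x y != G' x y) setT setT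
     + d * edge_count R G setT setT).
  apply: (@le_trans _ _ (q / 16%:R * #|far|%:R + _)); last first.
    by rewrite lerD2l; exact: ineq.
  have -> : #|far|%:R = \sum_k \sum_(x in fiber piX k) (x \in far)%:R :> R.
    rewrite -sum1_card natr_sum (partition_big piX predT) //=.
    apply: eq_bigr => k _; rewrite [LHS]big_mkcond [RHS]big_mkcond.
    by apply: eq_bigr => x _; rewrite !inE; case: (_ == k); case: (_ < _).
  rewrite /pairs !mulr_sumr -big_split /=; apply: ler_sum => k _.
  have [->|[x0 x0k]] := set_0Vmem (fiber piX k).
    by rewrite !big_set0 cards0 !mulr0 addr0.
  have n_gt0 : 0 < #|fiber piX k|%:R :> R by rewrite ltr0n; apply/card_gt0P; exists x0.
  set F := \sum_(x in _) (x \in far)%:R; set P := \sum_(x in _) _; set Z := \sum_(x in _) _.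
  have inner : q / 16%:R * P <= q / 16%:R * (#|fiber piX k|%:R * F) + Z.
    rewrite /F mulr_sumr !mulr_sumr -big_split /=; apply: ler_sum => x _.
    rewrite [#|_|%:R * _]mulr_natl -sumr_const !mulr_sumr -big_split /=.
    apply: ler_sum => x' _.
    have sum_ge0 : 0 <= \sum_(y in ~: Bad) (z (piY y) x' && G x y)%:R :> R.
      by apply: sumr_ge0 => y _; exact: ler0n.
    have q16 : 0 <= q / 16%:R by rewrite divr_ge0 ?ler0n // ltW.
    have [xfar|xfar] := boolP (x \in far).
      rewrite mulr1 -[leLHS]addr0 lerD // -[leRHS]mulr1 ler_wpM2l //.
      by case: (_ != _); rewrite ?ler01.
    rewrite mulr0 add0r; have [_|ne] := eqVneq; first by rewrite mulr0.
    by rewrite mulr1; exact: sep.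
  have ninv : 0 <= #|fiber piX k|%:R^-1 :> R by rewrite invr_ge0 ltW.
  have := ler_wpM2l ninv inner; rewrite mulrDr.
  have -> : #|fiber piX k|%:R^-1 * (q / 16%:R * (#|fiber piX k|%:R * F)) = q / 16%:R * F.
    by field; rewrite gt_eqF.
  by rewrite mulrCA.
have eG : edge_count R G setT setT = q * #|X|%:R.
  by rewrite pattern_graph_size -mulrA mulrC.
have q16_gt0 : 0 < q / 16%:R by rewrite divr_gt0 // ltr0n.
(* Edits and regularity cost [(5 + 1) * d * q * #|X|]; division by [q / 16] gives the coefficient
   96. *)
rewrite -(ler_pM2l q16_gt0).
apply: (le_trans low).
have h1 := ler_wpM2l (ltW q_gt0) D1.
move: few_edits h1; rewrite eG.
set E := edge_count _ _ _ _; lra.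
Qed.

End Refinement.
End Bits.
End Core.

Local Close Scope ring_scope.

(** * Ackermann growth *)

Lemma AckS k n : Ack k.+2 n.+1 = Ack k.+1 (Ack k.+2 n).
Proof. by []. Qed.

Lemma ltn_Ack k n : n < Ack k.+1 n.
Proof.
elim: k n => [|k IH] n; first exact: ltn_expl.
elim: n => // n lt_n; rewrite AckS; exact: leq_ltn_trans lt_n (IH _).
Qed.

Lemma leq_Ack k m n : m <= n -> Ack k.+1 m <= Ack k.+1 n.
Proof.
case: k => [|k]; first by move=> le_mn; rewrite leq_exp2l.
elim: n => [|n IH]; first by rewrite leqn0 => /eqP->.
rewrite leq_eqVlt => /orP[/eqP->//|/IH le_m]; rewrite (leq_trans le_m) // AckS.
exact/ltnW/ltn_Ack.
Qed.

(* [stage U t = (p, w, b)]: [w] and [p] are the numbers of vertex bits forced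
   after [t] and [t - 1] rounds, and [b] is the number of bits of the lower
   uniformity consumed so far; [U b] vertex bits follow from [b] such bits. *)
Fixpoint stage (U : nat -> nat) (t : nat) : nat * nat * nat :=
  if t is t'.+1 then
    let: (p, w, b) := stage U t' in
    let b' := b + 2 ^ (w - p - 3) in (w, U b', b')
  else (0, 10, 0).

Definition forced U t := (stage U t).1.2.

Definition right_len U t := (stage U t).1.2 - (stage U t).1.1.

(** The relation between the two block lengths is that of [exists_pattern]. *)
Definition left_len U t := 2 ^ (right_len U t - 3).

(** Refining [j] bits of [r + 1]-tuples is going to force [forced_bits r j] bits of the vertices. *)
Fixpoint forced_bits (r : nat) : nat -> nat :=
  if r is r'.+1 then forced (forced_bits r') else id.

Lemma offset_left_len U t : offset (left_len U) t = (stage U t).2.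
Proof.
elim: t => [|t IH]; first by rewrite offset0.
by rewrite offsetS IH /left_len /right_len /=; case: (stage U t) => [[p w] b].
Qed.

Lemma forcedS U t : forced U t.+1 = U (offset (left_len U) t.+1).
Proof.
by rewrite offset_left_len /forced /=; case: (stage U t) => [[p w] b].
Qed.

Lemma right_lenS U t : right_len U t.+1 = forced U t.+1 - forced U t.
Proof. by rewrite /right_len /forced /=; case: (stage U t) => [[p w] b]. Qed.

(** Invariant of the induction on [r]. The second clause is the gain from one left block when the
    right block has length [d]; in the last two, 128 is the length of the first left block,
    [2 ^ (10 - 3)]. *)
Definition grows (r : nat) (U : nat -> nat) : Prop :=
  [/\ forall x y, U x + y <= U (x + y),
      forall x d, 10 <= d -> U x + Ack r.+1 (d - 4) + 4 <= U (x + 2 ^ (d - 3)),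
      10 * r + 36 <= U 128 &
      Ack r.+1 1 + 14 <= U 128].

Section Growth.
Variables (r : nat) (U : nat -> nat).
Hypothesis growU : grows r U.

Lemma leq_exp_sub3 d : 10 <= d -> d + 4 <= 2 ^ (d - 3).
Proof.
move=> le_d; rewrite -(subnK le_d); move: (d - 10) => e.
have -> : e + 10 - 3 = e + 7 by lia.
elim: e => // e IH; rewrite (_ : e.+1 + 7 = (e + 7).+1) ?expnS //; lia.
Qed.

Lemma forced0 : forced U 0 = 10. Proof. by []. Qed.

Lemma forced1 : forced U 1 = U 128.
Proof. by rewrite forcedS offset_left_len. Qed.

(** If the present right block has length [d], the next one is the gain of [U] over [2 ^ (d - 3)]
    fresh bits, at least [Ack r.+1 (d - 4) + 4]. Iterating this is the recursion that defines
    [Ack r.+2]. *)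
Lemma right_len_bounds t :
  [/\ 10 * r + 26 + t <= right_len U t.+1,
      forced U t + right_len U t.+1 = forced U t.+1 &
      Ack r.+2 t.+1 + 4 <= right_len U t.+1].
Proof.
have [slope jump start1 start2] := growU.
elim: t => [|t [IH1 IH2 IH3]].
  have f0 : forced U 0 = 10 by [].
  have a1 : Ack r.+2 1 = Ack r.+1 1 by [].
  by rewrite right_lenS forced1 f0 a1; split; lia.
have d10 : 10 <= right_len U t.+1 by lia.
have e : forced U t.+2 = U (offset (left_len U) t.+1 + 2 ^ (right_len U t.+1 - 3)).
  by rewrite forcedS offsetS.
have s := slope (offset (left_len U) t.+1) (2 ^ (right_len U t.+1 - 3)).
rewrite -e -forcedS in s.
have j := jump (offset (left_len U) t.+1) _ d10; rewrite -e -forcedS in j.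
have l := leq_exp_sub3 d10.
have a : Ack r.+2 t.+2 <= Ack r.+1 (right_len U t.+1 - 4).
  by rewrite AckS leq_Ack //; lia.
by rewrite (right_lenS _ t.+1); split; lia.
Qed.

Lemma right_len_ge10 t : 10 <= right_len U t.
Proof. by case: t => // t; have [] := right_len_bounds t; lia. Qed.

Lemma Ack_right_len t : Ack r.+2 t + 4 <= right_len U t.
Proof. by case: t => // t; have [] := right_len_bounds t. Qed.

(** After [t] rounds the forced bits fill the right blocks 0 to [t] exactly, so the next round can
    use pattern [t]. *)
Lemma offset_right_len t : offset (right_len U) t.+1 = forced U t.
Proof.
elim: t => [|t IH]; first by rewrite offsetS offset0.
by rewrite offsetS IH; have [] := right_len_bounds t.
Qed.

Lemma forced_slope x y : forced U x + y <= forced U (x + y).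
Proof.
elim: y => [|y IH]; first by rewrite !addn0.
have [h1 h2 _] := right_len_bounds (x + y); rewrite !addnS; lia.
Qed.

Lemma forced_mono x y : x <= y -> forced U x <= forced U y.
Proof. by move=> /subnKC <-; rewrite (leq_trans _ (forced_slope _ _)) ?leq_addr. Qed.

Lemma forced_ge2 n : 1 < n -> 10 * r.+1 + 36 <= forced U n.
Proof.
have [h1 h2 _] := right_len_bounds 0; have [h1' h2' _] := right_len_bounds 1.
by move=> /forced_mono le_n; lia.
Qed.

Lemma forced_geS n : Ack r.+2 1 + 14 <= forced U n.+1.
Proof.
have [_ h2 h3] := right_len_bounds n.
have le_n := @forced_mono 0 n (leq0n n); rewrite forced0 in le_n.
have := @leq_Ack r.+1 1 n.+1 isT; lia.
Qed.

Lemma grows_forced : grows r.+1 (forced U).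
Proof.
split.
- exact: forced_slope.
- move=> x d le_d; have l := leq_exp_sub3 le_d.
  (* Only the last of the added rounds is counted: its block alone has at least
     [Ack r.+2 (d - 4) + 4] bits. *)
  have [y ey] : exists y, x + 2 ^ (d - 3) = y.+1.
    by exists (x + 2 ^ (d - 3)).-1; lia.
  have [_ h2 h3] := right_len_bounds y; rewrite ey -h2.
  have le_xy : forced U x <= forced U y by apply: forced_mono; lia.
  have := @leq_Ack r.+1 (d - 4) y.+1; lia.
- exact: (@forced_ge2 128).
exact: (forced_geS 127).
Qed.

End Growth.

Lemma grows_forced_bits r : grows r (forced_bits r).
Proof.
elim: r => [|r IH]; last exact: grows_forced.
split=> // x d le_d; rewrite /= -addnA leq_add2l.
have l := leq_exp_sub3 le_d.
have -> : d - 3 = (d - 4).+1 by lia.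
rewrite expnS; move: l; have -> : d - 3 = (d - 4).+1 by lia.
by rewrite expnS; lia.
Qed.

Local Open Scope ring_scope.

(** The lower bound on block lengths grows by one per round, so the terms [2 ^ - right_len U t] for
    positive [t] are dominated by a geometric series; the induction carries its partial sums. *)
Lemma deviation_right_len (R : realFieldType) r U T : grows r U ->
  deviation R (right_len U) T <= (2%:R ^+ (10 * r + 24))^-1.
Proof.
move=> growU; set K := (10 * r + 24)%N; pose x : R := (2%:R ^+ K.+1)^-1.
have x_gt0 : 0 < x by rewrite invr_gt0 exprn_gt0 // ltr0n.
have le_x : 2%:R * x <= 1.
  by rewrite /x ler_pdivrMr ?mul1r ?exprn_gt0 ?ltr0n // exprS ler_pMr ?ltr0n //
    exprn_ege1 // ler1n.
have -> : (2%:R ^+ K)^-1 = 2%:R * x :> R.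
  by rewrite /x exprS invfM mulrA divff ?mul1r // pnatr_eq0.
rewrite /deviation lerBlDl.
have half_gt0 n : 0 < (2%:R^-1 : R) ^+ n by rewrite exprn_gt0 // invr_gt0 ltr0n.
suff : \prod_(t < T) (if val t == 0%N then 1 else 1 + (2%:R ^+ right_len U t)^-1)
    <= 1 + 2%:R * x * (1 - 2%:R^-1 ^+ T.-1) :> R.
  have := half_gt0 T.-1; have := mulr_gt0 x_gt0 (half_gt0 T.-1); lra.
elim: T => [|[|T] IH]; rewrite ?big_ord0 ?big_ord_recr /=.
- by rewrite expr0 subrr mulr0 addr0.
- by rewrite big_ord0 mul1r expr0 subrr mulr0 addr0.
have [h1 _ _] := right_len_bounds growU T.
have e : (2%:R ^+ right_len U T.+1)^-1 <= x * 2%:R^-1 ^+ T.+1 :> R.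
  rewrite /x exprVn -invfM -exprD lef_pV2 ?posrE ?exprn_gt0 ?ltr0n //.
  by rewrite ler_weXn2l ?ler1n //; lia.
have p0 : 0 <= (2%:R ^+ right_len U T.+1)^-1 :> R by rewrite invr_ge0 exprn_ge0 ?ler0n.
rewrite big_ord_recr /= in IH.
apply: le_trans (ler_wpM2r _ IH) _; first by rewrite addr_ge0 ?ler01.
move: e p0; rewrite /= exprS; set p := (_ ^+ right_len _ _)^-1.
have := half_gt0 T; move: (_ ^+ T) => y y_gt0 e p0.
have a : 0 < x * y by rewrite mulr_gt0.
have b : 2%:R * x * (1 - y) <= 1 by lra.
have c := ler_wpM2r p0 b.
by lra.
Qed.

Lemma block_mkseq d t N (g : nat -> bool) : (offset d t.+1 <= N)%N ->
  block d t (mkseq g N) = mkseq (fun i => g (offset d t + i)%N) (d t).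
Proof.
rewrite offsetS => le_N; apply: (@eq_from_nth _ false).
  by rewrite size_takel ?size_mkseq // size_drop size_mkseq; lia.
move=> i; rewrite size_takel ?size_drop ?size_mkseq; last by lia.
move=> lti; rewrite nth_take // nth_drop !nth_mkseq //.
by rewrite (leq_trans _ le_N) // ltn_add2l.
Qed.

Lemma take_mkseq (T : Type) (g : nat -> T) i N : (i <= N)%N ->
  take i (mkseq g N) = mkseq g i.
Proof. by move=> le_iN; rewrite -map_take take_iota (minn_idPl le_iN). Qed.

(** * Iterating over the uniformity *)

Section Tower.
Variables (R : realFieldType) (M : nat).
Variable pat : nat -> seq bool -> seq bool -> bool.
Hypothesis patP : forall d, (10 <= d <= M)%N -> pattern R (2 ^ (d - 3)) d (pat d).
Hypothesis M_ge10 : (10 <= M)%N.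

Local Notation point := (M.-tuple bool).

Fixpoint points (r : nat) : finType :=
  if r is r'.+1 then (points r' * point)%type : finType else point.

(** The block of [p.1] is listed directly, so the bits do not depend on how many of them are used;
    [tower_bitS] recovers it as a block of any long enough [tower_bits]. *)
Fixpoint tower_bit (r : nat) : points r -> nat -> bool :=
  match r return points r -> nat -> bool with
  | 0 => fun v t => nth false v t
  | r'.+1 => fun p t =>
      let U := forced_bits r' in
      pat (right_len U t)
        (mkseq (fun i => tower_bit p.1 (offset (left_len U) t + i)%N) (left_len U t))
        (block (right_len U) t p.2)
  end.

Definition tower_bits r (p : points r) j := mkseq (tower_bit p) j.

Lemma tower_bitS r (p : points r) (v : point) N t :
  (offset (left_len (forced_bits r)) t.+1 <= N)%N ->
  tower_bit (r := r.+1) (p, v) t =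
  pattern_bit (fun p => tower_bits p N) (@tval M bool) (left_len (forced_bits r))
    (right_len (forced_bits r)) (fun t => pat (right_len (forced_bits r) t)) t p v.
Proof. by move=> le_N; rewrite /pattern_bit block_mkseq. Qed.

Lemma equidistributed_point : equidistributed R (@tval M bool) M.
Proof.
split=> [v|F]; first exact: size_tuple.
by rewrite sum_tuple_avg card_tuple card_bool natrX.
Qed.

Lemma tower_patternP r T : (forced_bits r.+1 T <= M)%N ->
  forall t, (t < T)%N ->
  pattern R (left_len (forced_bits r) t) (right_len (forced_bits r) t)
    (pat (right_len (forced_bits r) t)).
Proof.
move=> le_M t ltT; have gr := grows_forced_bits r; apply: patP.
rewrite (right_len_ge10 gr) /=; apply: leq_trans le_M.
apply: leq_trans (forced_mono gr (ltnW ltT)).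
by rewrite -(offset_right_len gr) offsetS leq_addl.
Qed.

Lemma offset_right_le r T : (forced_bits r.+1 T <= M)%N ->
  (offset (right_len (forced_bits r)) T <= M)%N.
Proof.
case: T => [|t] le_M; first by rewrite offset0.
have gr := grows_forced_bits r.
by rewrite (offset_right_len gr) (leq_trans _ le_M) // (forced_mono gr).
Qed.

Lemma offset_left_le r T : (forced_bits r.+1 T <= M)%N ->
  (forced_bits r (offset (left_len (forced_bits r)) T) <= M)%N.
Proof.
case: T => [|t] le_M; last by rewrite -forcedS.
by rewrite offset0; case: r {le_M}.
Qed.

Lemma equidistributed_tower r T : (forced_bits r T <= M)%N ->
  equidistributed R (fun p : points r => tower_bits p T) T.
Proof.
elim: r T => [|r IH] T le_M.
  split=> [v|F]; first by rewrite size_mkseq.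
  have mkE s s' : size s = T -> mkseq (nth false (s ++ s')) T = s.
    move=> sz; rewrite -[RHS](mkseq_nth false) sz; apply/eq_in_map => i.
    by rewrite mem_iota => /andP[_ lti]; rewrite nth_cat sz lti.
  rewrite (equidistributed_point.2 (fun s => F (mkseq (nth false s) T))).
  congr (_ * _); rewrite (avg_prefix le_M) => [|s s' sz].
    by apply: eq_avg => s sz; rewrite -{1}[s]cats0 mkE.
  by rewrite mkE // -{2}[s]cats0 mkE.
have := equidistributed_bits (IH _ (offset_left_le le_M)) equidistributed_point
  (tower_patternP le_M) (leqnn _) (offset_right_le le_M).
case=> sz eqF; split=> [p|F]; first by rewrite size_mkseq.
rewrite -eqF; apply: eq_bigr => -[p v] _; congr (F _).
apply/eq_in_map => t; rewrite mem_iota => /andP[_ ltT].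
by rewrite (@tower_bitS _ p v (offset (left_len (forced_bits r)) T)) // offset_mono.
Qed.

(** The factor 1024 between consecutive levels pays for the losses in [regular_graph_refines]. *)
Definition threshold r : R := (2%:R ^+ (10 * r.+1))^-1.

Lemma threshold_gt0 r : 0 < threshold r.
Proof. by rewrite invr_gt0 exprn_gt0 // ltr0n. Qed.

Lemma thresholdS r : threshold r = 1024%:R * threshold r.+1.
Proof.
have e : (2%:R : R) ^+ (10 * r.+2) = 2%:R ^+ (10 * r.+1) * 1024%:R.
  have -> : (10 * r.+2 = 10 * r.+1 + 10)%N by lia.
  by rewrite exprD -[2%:R ^+ 10]natrX.
by rewrite /threshold e; field; rewrite expf_neq0 // pnatr_eq0.
Qed.

Lemma threshold_le r : threshold r <= 1024%:R^-1.
Proof.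
elim: r => [|r IH]; first by rewrite /threshold muln1 -natrX.
by move: IH; rewrite (thresholdS r); have := threshold_gt0 r.+1; lra.
Qed.

(** The error is at most [(96 + 4096 / 16) * threshold r.+1], where 352 is below the 512 that are
    available. *)
Lemma threshold_deviation r T :
  96%:R * threshold r.+1 + 4096%:R * deviation R (right_len (forced_bits r)) T
  <= threshold r / 2%:R.
Proof.
have := deviation_right_len R T (grows_forced_bits r).
have -> : (2%:R ^+ (10 * r + 24))^-1 = threshold r.+1 / 16%:R :> R.
  have e : (10 * r + 24 = 10 * r.+2 + 4)%N by lia.
  by rewrite /threshold e exprD -[2%:R ^+ 4]natrX invfM.
rewrite (thresholdS r); have := threshold_gt0 r.+1; lra.
Qed.

Section Labels.
Variables (KE KV : finType) (labE : forall r, nat -> points r -> KE).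
Variable labV : nat -> point -> KV.

Definition tower_graph r j (eps : nat -> bool) (p : points r) (v : point) : bool :=
  [forall t : 'I_j, tower_bit (r := r.+1) (p, v) t == eps t].

(** The same error 1/128 is demanded for every [w], so nothing deteriorates from round to round. *)
Definition vertices_refine w : Prop := forall q,
  approx_refines (labV q) (fun v => take w (tval v)) (128%:R^-1 : R).

(** Here [p] lies on the classes [q] to [q + r] and [v] on the next one; the pattern [eps] may
    depend on [q]. *)
Definition regular_approx r j : Prop := forall q,
  exists (eps : nat -> bool) (G' : points r -> point -> bool),
    edge_count R (fun p v => @tower_graph r j eps p v != G' p v) setT setT <=
      threshold r.+1 * edge_count R (@tower_graph r j eps) setT setT /\
    forall p0 v0, regular (threshold r.+1) G'
      (fiber (@labE r q) (@labE r q p0)) (fiber (labV (q + r.+1)) (labV (q + r.+1) v0)).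

Definition forces r : Prop := forall j, (forced_bits r j <= M)%N ->
  (forall q, approx_refines (@labE r q) (fun p => tower_bits p j) (threshold r / 2%:R)) ->
  vertices_refine (forced_bits r j).

Hypothesis vertices_refine10 : vertices_refine 10.
Hypothesis labE0_labV : forall q j g,
  approx_refines (@labE 0 q) (fun v : point => take j (tval v)) g ->
  approx_refines (labV q) (fun v => take j (tval v)) (g : R).

Lemma approx_refines_weaken (X : finType) (K : Type) (pi : X -> K) lam (g g' : R) :
  g <= g' -> approx_refines pi lam g -> approx_refines pi lam g'.
Proof.
by move=> le_g [c cP]; exists c; apply: (le_trans cP); rewrite ler_wpM2r ?ler0n.
Qed.

Lemma eq_approx_refines (X : finType) (K : Type) (pi : X -> K) lam lam' (g : R) :
  lam =1 lam' -> approx_refines pi lam g -> approx_refines pi lam' g.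
Proof.
move=> eq_lam [c cP]; exists c; apply: le_trans cP.
by rewrite ler_nat subset_leq_card //; apply/subsetP => x; rewrite !inE eq_lam.
Qed.

Lemma regular_weaken (X Y : finType) (G : X -> Y -> bool) A B (d d' : R) :
  d <= d' -> regular d G A B -> regular d' G A B.
Proof.
move=> le_d reg A' B' sA sB leA leB; apply: reg => //.
  by apply: le_trans leA; rewrite ler_wpM2r ?ler0n.
by apply: le_trans leB; rewrite ler_wpM2r ?ler0n.
Qed.

Lemma forces0 : forces 0.
Proof.
move=> j /= le_jM ref q; apply: labE0_labV.
apply: (approx_refines_weaken _ (eq_approx_refines _ (ref q))).
  by have := threshold_le 0; have := threshold_gt0 0; lra.
move=> v; rewrite /tower_bits /=; apply: (@eq_from_nth _ false).
  by rewrite size_mkseq size_takel // size_tuple.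
by move=> i; rewrite size_mkseq => lti; rewrite nth_mkseq // nth_take.
Qed.

Lemma point_gt0 : (0 < #|{: point}|)%N.
Proof. by rewrite card_tuple card_bool expn_gt0. Qed.

(** One round: the refinement of the last class gives left blocks on [r + 1]-tuples by
    [regular_graph_refines], and [forces r] converts these into vertex bits on every class, in
    particular on the last one for each [q]. *)
Lemma regular_approx_refine r j : forces r -> (forced_bits r.+1 j <= M)%N ->
  regular_approx r j ->
  forall t, (t <= j)%N -> vertices_refine (forced_bits r.+1 t).
Proof.
move=> forces_r le_M approx; elim=> [_|t IH lt_tj]; first exact: vertices_refine10.
have gr := grows_forced_bits r.
set bs := left_len (forced_bits r); set ds := right_len (forced_bits r).
have le_off : (offset bs t.+1 <= offset bs j)%N by exact: offset_mono.
rewrite /= forcedS; apply: forces_r.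
  by rewrite -forcedS; apply: leq_trans le_M; exact: (forced_mono gr).
move=> q; have [eps [G' [edits reg]]] := approx q.
have h_eq := equidistributed_tower (offset_left_le le_M).
pose f t := pat (ds t).
pose pg := pattern_graph (fun p : points r => tower_bits p (offset bs j))
  (@tval M bool) bs ds f j eps.
have graphE p v : pg p v = @tower_graph r j eps p v.
  apply: eq_forallb => i; congr (_ == _).
  by rewrite (@tower_bitS _ p v (offset bs j)) // offset_mono.
have {}edits : edge_count R (fun p v => pg p v != G' p v) setT setT <=
    threshold r.+1 * edge_count R pg setT setT.
  have edgeE (H H' : points r -> point -> bool) : (forall p v, H p v = H' p v) ->
      edge_count R H setT setT = edge_count R H' setT setT.
    by move=> eH; apply: eq_bigr => p _; apply: eq_bigr => v _; rewrite eH.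
  rewrite (edgeE _ _ graphE) (edgeE _ (fun p v => @tower_graph r j eps p v != G' p v)) //.
  by move=> p v; rewrite graphE.
have le_half : threshold r.+1 <= 2%:R^-1 by have := threshold_le r.+1; lra.
have := @regular_graph_refines R _ _ _ _ _ _ bs ds f j h_eq equidistributed_point
  (tower_patternP le_M) (leqnn _) (offset_right_le le_M) eps _ _ (@labE r q)
  (labV (q + r.+1)) G' (threshold r.+1) t point_gt0 lt_tj (threshold_gt0 _).
move=> /(_ le_half reg edits); rewrite (offset_right_len gr).
move=> /(_ (IH (ltnW lt_tj) (q + r.+1)%N)) ref.
apply: (approx_refines_weaken (threshold_deviation r j)).
apply: eq_approx_refines ref => p; rewrite /tower_bits take_mkseq //.
Qed.

(** Labels of the larger tuples predict their [j] bits up to few errors. The tuples with predicted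
    bits [e] form a graph that is a union of parts, hence regular; averaging over [e] finds one that
    is close to a tower graph. *)
Lemma forcesS r : forces r ->
  (forall q (c : KE -> bool) p0 v0,
     regular (threshold r.+1) (fun p v => c (@labE r.+1 q (p, v)))
       (fiber (@labE r q) (@labE r q p0)) (fiber (labV (q + r.+1)) (labV (q + r.+1) v0))) ->
  forces r.+1.
Proof.
move=> forces_r good_r j le_M ref.
apply: (regular_approx_refine forces_r le_M _ (leqnn j)) => q.
have [c cP] := ref q.
have [sz eqF] := equidistributed_tower le_M.
set bad := [set p | _] in cP.
pose F (e : seq bool) : R :=
  \sum_(p : points r.+1) ((tower_bits p j == e) != (c (@labE r.+1 q p) == e))%:R.
have pow_gt0 : 0 < (2%:R : R) ^+ j by rewrite exprn_gt0 // ltr0n.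
(* A mispredicted tuple counts as an edit for two values of [e] at most, its true and its predicted
   bits. *)
have : avg j F <= 2%:R / 2%:R ^+ j * #|bad|%:R.
  rewrite /F avg_sum -sum1_card natr_sum mulr_sumr [leRHS]big_mkcond /=.
  apply: ler_sum => p _; rewrite inE; case: eqVneq => [<-|ne].
    rewrite (@eq_avg _ _ _ (fun=> 0)) ?avg_const // => e _.
    by rewrite eqxx.
  rewrite /= mulr1.
  pose H (e : seq bool) : R := (e == @tower_bits r.+1 p j)%:R + (e == c (@labE r.+1 q p))%:R.
  have : avg j H <= 2%:R / 2%:R ^+ j.
    have le2 (a b : bool) : a%:R + b%:R <= 2%:R :> R.
      by case: a; case: b; rewrite /=; lra.
    rewrite avgD !avg_eq -mulrDl; apply: ler_wpM2r; last exact: le2.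
    by rewrite invr_ge0 (ltW pow_gt0).
  apply: le_trans.
  apply: le_avg => e _; rewrite /H ![_ == e]eq_sym.
  by case: (e == _); case: (e == _); rewrite /=; lra.
case/exists_le_avg => e sze leF.
pose eps := nth false e.
have graphE p v : @tower_graph r j eps p v = (tower_bits (r := r.+1) (p, v) j == e).
  rewrite /tower_graph -[e in RHS](mkseq_nth false) sze.
  apply/forallP/eqP => [allE|/eq_in_map eqE t].
    apply/eq_in_map => t; rewrite mem_iota => /andP[_ lt_t].
    exact: (eqP (allE (Ordinal lt_t))).
  by apply/eqP; apply: eqE; rewrite mem_iota /=.
exists eps, (fun p v => c (@labE r.+1 q (p, v)) == e); split; last first.
  by move=> p0 v0; exact: (good_r q (fun l => c l == e)).
have -> : edge_count R (@tower_graph r j eps) setT setT =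
    #|points r.+1|%:R / 2%:R ^+ j.
  rewrite -[RHS]mulr1 -mulrA.
  have := eqF (fun s => (s == e)%:R); rewrite avg_eq sze eqxx mul1r mulr1 => <-.
  rewrite edge_countT; apply: eq_bigr => -[p v] _.
  by rewrite graphE.
have -> : edge_count R (fun p v => @tower_graph r j eps p v !=
    (c (@labE r.+1 q (p, v)) == e)) setT setT = F e.
  by rewrite edge_countT; apply: eq_bigr => -[p v] _; rewrite graphE.
apply: (le_trans leF).
have inv_ge0 : 0 <= 2%:R / (2%:R : R) ^+ j by rewrite divr_ge0 ?ler0n // ltW.
apply: le_trans (ler_wpM2l inv_ge0 cP) _.
by rewrite le_eqVlt; apply/orP; left; apply/eqP; field; rewrite gt_eqF.
Qed.

End Labels.
End Tower.

(** * From graphs as edge sets to relations between types *)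

Section Transfer.
Variables (X Y Z : finType) (i : X -> Z) (j : Y -> Z).
Hypotheses (i_inj : injective i) (j_inj : injective j).

Lemma edges_between_imset (G : {set {set Z}}) (A : {set X}) (B : {set Y}) :
  (edges_between G (i @: A) (j @: B))%:R =
  edge_count rat (fun x y => [set i x; j y] \in G) A B.
Proof.
pose f (p : X * Y) := (i p.1, j p.2).
have f_inj : injective f by move=> [x y] [x' y'] [/i_inj -> /j_inj ->].
have -> : edges_between G (i @: A) (j @: B) =
    #|f @: [set p in setX A B | [set i p.1; j p.2] \in G]|.
  congr #|pred_of_set _|; apply/setP => -[z z']; rewrite !inE /=.
  apply/andP/imsetP => [[/andP[/imsetP[x xA ->] /imsetP[y yB ->]] zG]|].
    by exists (x, y); rewrite // !inE xA yB.
  case=> -[x y]; rewrite !inE /= => /andP[/andP[xA yB] xyG] [-> ->].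
  by rewrite !imset_f.
rewrite card_imset // /edge_count pair_big /= -sum1_card natr_sum.
rewrite [LHS]big_mkcond [RHS]big_mkcond /=.
apply: eq_bigr => -[x y] _; rewrite !inE /=.
by case: (x \in A); case: (y \in B); case: (_ \in G).
Qed.

Lemma regular_pair_imset (d : rat) (G : {set {set Z}}) (A : {set X}) (B : {set Y}) :
  0 < d -> regular_pair d G (i @: A) (j @: B) ->
  regular d (fun x y => [set i x; j y] \in G) A B.
Proof.
move=> d_gt0 reg A' B' sA sB leA leB.
have [->|[x0 x0A]] := set_0Vmem A.
  by rewrite /edge_count big_set0 mul0r cards0 mul0r mulr0.
have [->|[y0 y0B]] := set_0Vmem B.
  have -> : edge_count rat (fun x y => [set i x; j y] \in G) A set0 = 0.
    by rewrite /edge_count big1 // => x _; rewrite big_set0.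
  by rewrite mul0r cards0 !mulr0.
have A_gt0 : 0 < #|A|%:R :> rat by rewrite ltr0n; apply/card_gt0P; exists x0.
have B_gt0 : 0 < #|B|%:R :> rat by rewrite ltr0n; apply/card_gt0P; exists y0.
have A'_gt0 : 0 < #|A'|%:R :> rat by apply: lt_le_trans leA; rewrite mulr_gt0.
have B'_gt0 : 0 < #|B'|%:R :> rat by apply: lt_le_trans leB; rewrite mulr_gt0.
have := reg (i @: A') (j @: B').
rewrite !card_imset // => /(_ (imsetS _ sA) (imsetS _ sB) leA leB).
rewrite /pair_density !card_imset // !edges_between_imset !natrM.
move: (edge_count _ _ A B) (edge_count _ _ A' B') #|A|%:R #|B|%:R #|A'|%:R #|B'|%:R
  A_gt0 B_gt0 A'_gt0 B'_gt0.
clear=> e e' a b a' b' a0 b0 a'0 b'0.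
rewrite ler_pdivlMr ?mulr_gt0 // mulrA mulrAC ler_pdivrMr ?mulr_gt0 //.
move=> h; lra.
Qed.

End Transfer.

Lemma eq_in_regular (X Y : finType) (d : rat) (G G' : X -> Y -> bool)
    (A : {set X}) (B : {set Y}) :
  {in A & B, forall x y, G x y = G' x y} -> regular d G A B -> regular d G' A B.
Proof.
move=> eqG reg A' B' sA sB leA leB.
have eqE (A1 : {set X}) (B1 : {set Y}) : A1 \subset A -> B1 \subset B ->
    edge_count rat G' A1 B1 = edge_count rat G A1 B1.
  move=> /subsetP sA1 /subsetP sB1; apply: eq_bigr => x /sA1 xA.
  by apply: eq_bigr => y /sB1 yB; rewrite eqG.
by rewrite !eqE //; exact: reg.
Qed.

(** With denominators cleared, regularity is a linear inequality in edge counts, so it passes to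
    disjoint unions on the same pair. *)
Lemma regular_sum (X Y I : finType) (P : pred I) (d : rat) (G : X -> Y -> bool)
    (Gi : I -> X -> Y -> bool) (A : {set X}) (B : {set Y}) :
  (forall x y, (G x y)%:R = \sum_(i | P i) (Gi i x y)%:R :> rat) ->
  (forall i, P i -> regular d (Gi i) A B) -> regular d G A B.
Proof.
move=> eqG reg A' B' sA sB leA leB.
have eqE (A1 : {set X}) (B1 : {set Y}) :
    edge_count rat G A1 B1 = \sum_(i | P i) edge_count rat (Gi i) A1 B1.
  rewrite exchange_big /=; apply: eq_bigr => x _.
  by rewrite exchange_big /=; apply: eq_bigr => y _; rewrite eqG.
rewrite !eqE mulr_suml mulr_sumr mulr_suml; apply: ler_sum => i Pi.
exact: reg.
Qed.

(** Moving the window of [k] consecutive integers by one replaces [q] by [q + k], which has the same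
    residue. *)
Lemma sum_modn k q j : (j < k)%N -> (\sum_(a < k) ((q + a) %% k == j) = 1)%N.
Proof.
move=> lt_jk; have k_gt0 : (0 < k)%N by exact: leq_ltn_trans lt_jk.
elim: q => [|q IH].
  rewrite (bigD1 (Ordinal lt_jk)) //= add0n modn_small // eqxx big1 // => a ne_a.
  by rewrite add0n modn_small // -val_eqE /= in ne_a *; rewrite (negPf ne_a).
case: k lt_jk k_gt0 IH => // k lt_jk _ IH.
rewrite -{}IH big_ord_recr big_ord_recl /= addnC addSnnS modnDr addn0; congr (_ + _)%N.
by apply: eq_bigr => a _; rewrite addSnnS.
Qed.

(** * The hypergraph *)

Section Hypergraph.
Variables k M : nat.
Hypothesis k_gt0 : (0 < k)%N.

Local Notation point := (M.-tuple bool).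
Local Notation vertex := ('I_(2 * k) * M.-tuple bool)%type.

Lemma double_gt0 : (0 < 2 * k)%N. Proof. by rewrite muln_gt0. Qed.

Definition cyc (a : nat) : 'I_(2 * k) := Ordinal (ltn_pmod a double_gt0).

Lemma cyc_inj q a b : (a < 2 * k)%N -> (b < 2 * k)%N ->
  cyc (q + a) = cyc (q + b) -> a = b.
Proof.
move=> lta ltb /(congr1 val) /= /eqP; rewrite eqn_modDl !modn_small //.
by move/eqP.
Qed.

(* The edge on the classes [q, ..., q + r] modulo [2 * k]. *)
Fixpoint edge (q r : nat) : points M r -> {set vertex} :=
  match r return points M r -> {set vertex} with
  | 0 => fun v => [set (cyc q, v)]
  | r'.+1 => fun p => (cyc (q + r'.+1), p.2) |: edge q p.1
  end.

Lemma edge_class q r (p : points M r) x : x \in edge q p ->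
  exists2 a, (a <= r)%N & x.1 = cyc (q + a).
Proof.
elim: r p => [|r IH] p /=.
  by rewrite inE => /eqP->; exists 0%N; rewrite ?addn0.
case/setU1P => [->|/IH[a le_a ->]]; first by exists r.+1.
by exists a; rewrite // ltnW.
Qed.

Lemma edge_rep q r (p : points M r) a : (a <= r)%N ->
  exists2 x, x \in edge q p & x.1 = cyc (q + a).
Proof.
elim: r p => [|r IH] p /=.
  by rewrite leqn0 => /eqP->; exists (cyc q, p); rewrite ?inE ?eqxx //= addn0.
rewrite leq_eqVlt => /orP[/eqP->|/IH-/(_ p.1)[x xp eqx]].
  by exists (cyc (q + r.+1), p.2); rewrite // setU11.
by exists x; rewrite // setU1r.
Qed.

Lemma edge_new q r (p : points M r) v :
  (r.+1 < 2 * k)%N -> (cyc (q + r.+1), v) \notin edge q p.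
Proof.
move=> lt_r; apply/negP => /edge_class[a le_a /=] /(cyc_inj lt_r).
by move=> e; have := e (leq_ltn_trans le_a (ltnW lt_r)); lia.
Qed.

Lemma edge_class_inj q r (p : points M r) x y : (r < 2 * k)%N ->
  x \in edge q p -> y \in edge q p -> x.1 = y.1 -> x = y.
Proof.
elim: r p => [|r IH] p lt_r /=; first by move=> /set1P-> /set1P->.
have old z : z \in edge q p.1 -> cyc (q + r.+1) <> z.1.
  move=> zp eqz; have := edge_new q p.1 z.2 lt_r.
  by rewrite eqz -surjective_pairing zp.
case/setU1P => [->|xp] /setU1P[->|yp] //= eq1.
- by case: (old _ yp eq1).
- by case: (old _ xp (esym eq1)).
exact: (IH p.1 (ltnW lt_r)).
Qed.

Lemma card_edge q r (p : points M r) : (r < 2 * k)%N -> #|edge q p| = r.+1.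
Proof.
elim: r p => [|r IH] p lt_r /=; first by rewrite cards1.
by rewrite cardsU1 edge_new // IH // ltnW.
Qed.

Lemma edge_inj q r : (r < 2 * k)%N -> injective (@edge q r).
Proof.
elim: r => [|r IH] lt_r p p' /=; first by move=> /set1_inj [].
case: p p' => p v [p' v'] /= eqE.
have eqv : v = v'.
  have : (cyc (q + r.+1), v) \in (cyc (q + r.+1), v') |: edge q p'.
    by rewrite -eqE setU11.
  by rewrite !inE (negPf (edge_new _ _ _ lt_r)) orbF => /eqP[].
congr (_, _); last exact: eqv.
apply: (IH (ltnW lt_r)); rewrite -[LHS](setU1K (edge_new q p v lt_r)) eqE eqv.
exact: setU1K (edge_new q p' v' lt_r).
Qed.

Lemma edge_surj q r (e : {set vertex}) : (r < 2 * k)%N -> #|e| = r.+1 ->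
  (forall a, (a <= r)%N -> exists2 x, x \in e & x.1 = cyc (q + a)) ->
  exists p : points M r, e = edge q p.
Proof.
elim: r e => [|r IH] e lt_r card_e rep.
  have /cards1P[[a v] eqe] : #|e| == 1%N by rewrite card_e.
  have [x] := rep 0%N (leqnn _); rewrite eqe => /set1P -> /= eqa.
  by exists v; rewrite /= eqa addn0.
have [[a v] ve /= eqa] := rep r.+1 (leqnn _); rewrite {}eqa in ve.
have [||p eqp] := IH (e :\ (cyc (q + r.+1), v)) (ltnW lt_r).
- by move: card_e; rewrite (cardsD1 (cyc (q + r.+1), v)) ve => -[].
- move=> b le_b; have [x xe eqx] := rep b (leqW le_b); exists x => //.
  rewrite !inE xe andbT; apply/negP => /eqP eqx'.
  move: eqx; rewrite eqx' /= => /(cyc_inj lt_r) e1.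
  by have := e1 (leq_ltn_trans le_b (ltnW lt_r)); lia.
by exists (p, v); rewrite /= -eqp setD1K.
Qed.

(** Each of the [k] classes of the hypergraph joins two opposite cyclic classes, so any [k]
    consecutive cyclic classes meet each of them once. *)
Definition vclass (i : 'I_k) : {set vertex} := [set x : vertex | (x.1 %% k == i)%N].

Lemma card_edge_vclass q r (p : points M r) (i : 'I_k) : (r < 2 * k)%N ->
  #|edge q p :&: vclass i| = (\sum_(a < r.+1) ((q + a) %% k == i))%N.
Proof.
have cyc_mod a : (cyc a %% k = a %% k)%N by rewrite /= modn_dvdm // dvdn_mull.
elim: r p => [|r IH] p lt_r /=.
  rewrite big_ord_recl big_ord0 !addn0 -(cyc_mod q); case: eqP => eq_i.
    by rewrite (setIidPl _) ?cards1 // sub1set inE /= eq_i.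
  by apply/eqP; rewrite cards_eq0 setI_eq0 disjoints1 inE; apply/eqP.
rewrite big_ord_recr /= -(IH p.1 (ltnW lt_r)) setIUl -(cyc_mod (q + r.+1)) [RHS]addnC.
have new := edge_new q p.1 p.2 lt_r.
case: eqP => eq_i.
  rewrite (setIidPl _) ?sub1set ?inE /= ?eq_i //.
  by rewrite cardsU1 in_setI (negPf new).
by rewrite (_ : [set _] :&: _ = set0) ?set0U //; apply/eqP;
   rewrite setI_eq0 disjoints1 inE; apply/eqP.
Qed.

Lemma vclass_disjoint : disjoint_classes vclass.
Proof.
move=> i j ne; rewrite -setI_eq0; apply/eqP/setP => x; rewrite !inE.
by apply/negP => /andP[/eqP-> /eqP/val_inj eq_ij]; rewrite eq_ij eqxx in ne.
Qed.

Lemma vclass_cover : \bigcup_i vclass i = setT.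
Proof.
apply/setP => x; rewrite !inE; apply/bigcupP.
by exists (Ordinal (ltn_pmod x.1 k_gt0)); rewrite // inE.
Qed.

Lemma card_vclass i : #|vclass i| = (2 * 2 ^ M)%N.
Proof.
have -> : vclass i = setX [set a : 'I_(2 * k) | (a %% k == i)%N] setT.
  by apply/setP => x; rewrite !inE andbT.
rewrite cardsX cardsT card_tuple card_bool; congr (_ * _)%N.
rewrite -sum1_card big_mkcond /=.
transitivity (\sum_(a < 2 * k) (a %% k == i))%N.
  by apply: eq_bigr => a _; rewrite inE; case: (_ == _).
rewrite mul2n -addnn big_split_ord /=.
have s q := sum_modn q (ltn_ord i).
by rewrite (s k) (eq_bigr (fun a : 'I_k => nat_of_bool ((0 + a) %% k == i)%N)) ?s.
Qed.

Lemma edge_prod r q (p : points M r) (i : 'I_k) : r.+2 = k ->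
  i = ((q + r.+1) %% k)%N :> nat -> edge q p \in prod_edges vclass [pred j | j != i].
Proof.
move=> eqk eqi; have lt_r : (r < 2 * k)%N by lia.
have card_j j : #|edge q p :&: vclass j| = (j != i).
  have : (\sum_(0 <= a < r.+2) ((q + a) %% k == j) = 1)%N.
    by rewrite eqk big_mkord sum_modn.
  rewrite card_edge_vclass // big_nat_recr // big_mkord /=.
  rewrite -eqi -val_eqE eq_sym; case: (_ == _) => /=; first by lia.
  by rewrite addn0.
rewrite inE; apply/andP; split; last first.
  by apply/forallP => j; apply/implyP => /= ne; rewrite card_j ne.
apply/subsetP => x xp; have : x \in \bigcup_j vclass j by rewrite vclass_cover inE.
case/bigcupP => j _ xj; apply/bigcupP; exists j => //=.
have : (0 < #|edge q p :&: vclass j|)%N by apply/card_gt0P; exists x; rewrite inE xp.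
by rewrite card_j lt0b.
Qed.

End Hypergraph.

(** * Labels given by the parts of a partition *)

Section Partition.
Variables k M : nat.
Hypothesis k_gt0 : (0 < k)%N.

Local Notation point := (M.-tuple bool).
Local Notation vertex := ('I_(2 * k) * M.-tuple bool)%type.
Local Notation cyc := (cyc k_gt0).
Local Notation edge := (@edge k M k_gt0).

(** The ten bits are those with which [stage] starts. *)
Definition initial_label (x : vertex) : 'I_(2 * k) * 10.-tuple bool :=
  (x.1, [tuple nth false x.2 i | i < 10]).

Definition initial_partition : {set {set vertex}} :=
  preim_partition initial_label setT.

Lemma initial_partitionP : partition initial_partition setT.
Proof. exact: preim_partitionP. Qed.

Lemma card_initial_partition : (#|initial_partition| <= 2 ^ 11 * k)%N.
Proof.
have -> : initial_partition =
    (fun c => [set x | initial_label x == c]) @: (initial_label @: setT).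
  rewrite -imset_comp; apply: eq_imset => x; apply/setP => y.
  by rewrite !inE eq_sym.
apply: leq_trans (leq_imset_card _ _) _; apply: leq_trans (max_card _) _.
by rewrite card_prod card_ord card_tuple card_bool mulnAC -expnS.
Qed.

Variable P : kpart vertex.
Hypothesis kpartP : kpartition k.-1 setT P.
Hypothesis refP : refines (vparts P) initial_partition.

Lemma vparts_label Z x y : Z \in vparts P -> x \in Z -> y \in Z ->
  initial_label x = initial_label y.
Proof.
move=> /refP[B /imsetP[z _ ->] /subsetP sZ] /sZ xB /sZ yB.
by move: xB yB; rewrite !inE /= => /eqP <- /eqP <-.
Qed.

Lemma vparts_trivIset : trivIset (vparts P).
Proof. by case/and3P: kpartP.1. Qed.

Definition vertex_label q (v : point) : {set vertex} := pblock (vparts P) (cyc q, v).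

Definition edge_label r q (p : points M r) : {set {set vertex}} :=
  pblock (level P r.+1) (edge q p).

Lemma mem_cover_vparts x : x \in cover (vparts P).
Proof. by rewrite (cover_partition kpartP.1) inE. Qed.

Lemma vertex_label_mem q v : vertex_label q v \in vparts P.
Proof. exact: pblock_mem (mem_cover_vparts _). Qed.

Lemma mem_vertex_label q v : (cyc q, v) \in vertex_label q v.
Proof. by rewrite mem_pblock mem_cover_vparts. Qed.

Lemma vertex_labelE q v Z : Z \in vparts P -> (cyc q, v) \in Z -> vertex_label q v = Z.
Proof. exact: def_pblock vparts_trivIset. Qed.

Definition singletons (Z : {set vertex}) : {set {set vertex}} := [set [set z] | z in Z].

Lemma mem_singletons Z z : ([set z] \in singletons Z) = (z \in Z).
Proof.
by apply/imsetP/idP => [[z' z'Z /set1_inj ->]|zZ] //; exists z.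
Qed.

Lemma trivIset_level1 : trivIset (level P 1).
Proof.
apply/trivIsetP => A B /imsetP[Z ZP ->] /imsetP[Z' Z'P ->] ne.
rewrite -setI_eq0; apply/eqP/setP => e; rewrite !inE.
apply/negP => /andP[/imsetP[z zZ ->]]; rewrite mem_singletons => zZ'.
case/negP: ne; apply/eqP; congr (singletons _).
by rewrite -(def_pblock vparts_trivIset ZP zZ) (def_pblock vparts_trivIset Z'P zZ').
Qed.

Lemma singletons_level Z : Z \in vparts P -> singletons Z \in level P 1.
Proof. by move=> ZP; rewrite /level /= imset_f. Qed.

Lemma edge_label0 q (v : point) : edge_label (r := 0) q v = singletons (vertex_label q v).
Proof.
apply: (def_pblock trivIset_level1); first exact/singletons_level/vertex_label_mem.
by rewrite mem_singletons mem_vertex_label.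
Qed.

Lemma level_size r F e : (1 <= r <= k.-1)%N -> F \in level P r -> e \in F -> #|e| = r.
Proof.
move=> /andP[r_gt0 le_rk] FP eF.
have [eqr|ne_r] := eqVneq r 1%N.
  by move: FP eF; rewrite eqr => /imsetP[Z _ ->] /imsetP[z _ ->]; rewrite cards1.
have [| part _] := kpartP.2 r; first by lia.
have : e \in cover (level P r) by apply/bigcupP; exists F.
by rewrite (cover_partition part) inE => /and3P[_ /eqP].
Qed.

Lemma trivIset_level r : (1 <= r <= k.-1)%N -> trivIset (level P r).
Proof.
move=> le_r; have [->|ne_r] := eqVneq r 1%N; first exact: trivIset_level1.
by have [|/and3P[]] := kpartP.2 r; first by lia.
Qed.

Lemma edge_cover_level q r (p : points M r) : (r.+1 <= k.-1)%N ->
  edge q p \in cover (level P r.+1).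
Proof.
move=> le_r; have lt_r : (r < 2 * k)%N by lia.
case: r p le_r lt_r => [|r] p le_r lt_r.
  apply/bigcupP; exists (singletons (vertex_label q p)).
    exact/singletons_level/vertex_label_mem.
  by rewrite mem_singletons mem_vertex_label.
have [|part _] := kpartP.2 r.+2; first by lia.
rewrite (cover_partition part) inE subsetT card_edge // eqxx /=.
apply/forallP => Z; apply/implyP => ZP; rewrite leqNgt; apply/negP.
case/card_gt1P => x [y [/setIP[xp xZ] /setIP[yp yZ]]].
have [eq1 _] := vparts_label ZP xZ yZ.
by rewrite (edge_class_inj lt_r xp yp eq1) eqxx.
Qed.

Lemma mem_edge_label q r (p : points M r) : (r.+1 <= k.-1)%N ->
  edge q p \in edge_label q p.
Proof. by move=> le_r; rewrite mem_pblock edge_cover_level. Qed.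

Lemma edge_label_mem q r (p : points M r) : (r.+1 <= k.-1)%N ->
  edge_label q p \in level P r.+1.
Proof. by move=> le_r; apply: pblock_mem; exact: edge_cover_level. Qed.

Lemma edge_labelE q r (p : points M r) F : (r.+1 <= k.-1)%N ->
  F \in level P r.+1 -> edge q p \in F -> edge_label q p = F.
Proof. by move=> le_r; apply: def_pblock; exact: trivIset_level. Qed.

(** All members of [F] are transversals of the same vertex parts, namely the classes of its polyad,
    and each vertex part lies in a single cyclic class. *)
Lemma level_edges q r (p : points M r) F e : (r.+1 <= k.-1)%N ->
  F \in level P r.+1 -> edge q p \in F -> e \in F ->
  exists p' : points M r, e = edge q p'.
Proof.
move=> le_r FP; have lt_r : (r < 2 * k)%N by lia.
case: r p le_r lt_r FP => [|r] p le_r lt_r FP pF eF.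
  move: FP pF eF => /imsetP[Z ZP ->]; rewrite mem_singletons => pZ /imsetP[z zZ ->].
  have [eq1 _] := vparts_label ZP pZ zZ.
  by exists z.2; rewrite /= eq1 -surjective_pairing.
apply: edge_surj => //; first by apply: level_size FP eF; lia.
move=> a le_a; have [x xp <-] := edge_rep k_gt0 q p le_a.
have [|_ /(_ _ FP)[W [E [[_ WP _] /subsetP subF]]]] := kpartP.2 r.+2; first by lia.
have : edge q p \in cliques W E by exact: subF.
rewrite !inE => /andP[/andP[/subsetP subW _] _].
have /bigcupP[i _ xW] := subW _ xp.
have := subF _ eF; rewrite !inE => /andP[/andP[_ /forallP/(_ i)/= /cards1P[y eqy]] _].
have /setIP[ye yW] : y \in e :&: W i by rewrite eqy inE.
by exists y => //; have [->] := vparts_label (WP i) xW yW.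
Qed.

(** Identifies the sides of the auxiliary graph to which goodness of [F] applies: they are the
    fibers of the labels of [p] and [v]. *)
Lemma under_last q r (p : points M r) (v : point) F (W : 'I_r.+2 -> {set vertex}) E :
  (r.+2 <= k.-1)%N -> under k.-1 P F W E -> edge q ((p, v) : points M r.+1) \in F ->
  exists2 i, polyad_part W E i = edge_label q p & W i = vertex_label (q + r.+1) v.
Proof.
move=> le_r [[_ WP part] /subsetP subF] pvF.
have lt_r : (r.+1 < 2 * k)%N by lia.
have := subF _ pvF; rewrite !inE => /andP[/andP[/subsetP subW /forallP one] /forallP clique].
set x := (cyc (q + r.+1), v).
have xe : x \in edge q ((p, v) : points M r.+1) by rewrite /= setU11.
have /bigcupP[i _ xW] := subW _ xe.
exists i; last by rewrite (vertex_labelE (WP i) xW).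
have pE : edge q p \in polyad_part W E i.
  rewrite inE; apply/andP; split.
    apply: (implyP (clique (edge q p))).
    by rewrite card_edge ?eqxx ?andbT ?subsetUr // ltnW.
  apply/subsetP => y yp.
  have ye : y \in edge q ((p, v) : points M r.+1) by rewrite /= setU1r.
  have /bigcupP[j _ yW] := subW _ ye.
  apply/bigcupP; exists j => //; apply/eqP => eq_ij.
  have /cards1P[z eqz] := one i; rewrite eq_ij in yW.
  have : x \in edge q ((p, v) : points M r.+1) :&: W i by rewrite inE xe.
  have : y \in edge q ((p, v) : points M r.+1) :&: W i by rewrite inE ye.
  rewrite eqz => /set1P eqy /set1P eqx.
  by have := edge_new k_gt0 q p v lt_r; rewrite -/x eqx -eqy yp.
(* The component might come from any level; the size of [edge q p] tells which. *)
have [r' [le_r' inP]] := part i.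
have := level_size le_r' inP pE; rewrite card_edge; last by lia.
by move=> eqr; rewrite -eqr in inP; rewrite (edge_labelE _ inP pE) //; lia.
Qed.

Lemma edge_fiber q r (p : points M r) : (r.+1 <= k.-1)%N ->
  [set edge q p' | p' in fiber (@edge_label r q) (edge_label q p)] = edge_label q p.
Proof.
move=> le_r; apply/setP => e; apply/imsetP/idP => [[p']|ep].
  by rewrite inE => /eqP <- ->; exact: mem_edge_label.
have lP := edge_label_mem q p le_r.
have [p' eqe] := level_edges le_r lP (mem_edge_label q p le_r) ep.
by exists p' => //; rewrite inE; apply/eqP; apply: edge_labelE => //; rewrite -eqe.
Qed.

Lemma vertex_fiber q v :
  [set (cyc q, v') | v' in fiber (vertex_label q) (vertex_label q v)] = vertex_label q v.
Proof.
apply/setP => x; apply/imsetP/idP => [[v']|xv].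
  by rewrite inE => /eqP <- ->; exact: mem_vertex_label.
have [eq1 _] := vparts_label (vertex_label_mem q v) (mem_vertex_label q v) xv.
exists x.2; last by rewrite eq1 -surjective_pairing.
rewrite inE; apply/eqP; apply: vertex_labelE; first exact: vertex_label_mem.
by rewrite eq1 -surjective_pairing.
Qed.

Lemma mem_aux_graph n (W : 'I_n -> {set vertex}) F (i : 'I_n) e x :
  ([set inl e; inr x] \in aux_graph W F i) =
  [&& e \in prod_edges W [pred j | j != i], x \in W i & x |: e \in F].
Proof.
apply/imsetP/idP => [[[e' x']]|exF]; last by exists (e, x); rewrite // inE.
rewrite inE /= => exF eqs.
have : inl e \in [set inl e'; inr x'] by rewrite -eqs set21.
have : inr x \in [set inl e'; inr x'] by rewrite -eqs set22.
by rewrite !in_set2 => /orP[/eqP//|/eqP[->]] /orP[/eqP[->]|/eqP].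
Qed.

Lemma inl_edge_inj q r : (r < 2 * k)%N ->
  injective (fun p : points M r => inl (edge q p) : {set vertex} + vertex).
Proof. by move=> lt_r p p' [] /(edge_inj lt_r). Qed.

Lemma inr_vertex_inj q :
  injective (fun v : point => inr (cyc q, v) : {set vertex} + vertex).
Proof. by move=> v v' []. Qed.

Lemma aux_left_fiber q r (p : points M r) : (r.+1 <= k.-1)%N ->
  [set inl (edge q p') | p' in fiber (@edge_label r q) (edge_label q p)] =
  aux_left (edge_label q p).
Proof. by move=> le_r; rewrite -[in RHS](edge_fiber q p le_r) /aux_left -imset_comp. Qed.

Lemma aux_right_fiber q v :
  [set inr (cyc q, v') | v' in fiber (vertex_label q) (vertex_label q v)] =
  aux_right (vertex_label q v).
Proof. by rewrite -[in RHS](vertex_fiber q v) /aux_right -imset_comp. Qed.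

(** The graph is the disjoint union over the parts [F] selected by [c]. Each [F] is either empty on
    this pair of fibers or, by [under_last], has the pair as the two sides of an auxiliary graph. *)
Lemma good_label_regular (d : rat) r q (c : {set {set vertex}} -> bool)
    (p0 : points M r) v0 : good k.-1 d P -> 0 < d ->
  (r.+2 <= k.-1)%N ->
  regular d (fun p v => c (@edge_label r.+1 q (p, v)))
    (fiber (@edge_label r q) (edge_label q p0))
    (fiber (vertex_label (q + r.+1)) (vertex_label (q + r.+1) v0)).
Proof.
move=> goodP d_gt0 le_r; have lt_r : (r < 2 * k)%N by lia.
pose GF (F : {set {set vertex}}) (p : points M r) (v : point) : bool :=
  edge q ((p, v) : points M r.+1) \in F.
apply: (@regular_sum _ _ _ [pred F | (F \in level P r.+2) && c F] _ _ GF).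
  move=> p v; pose F0 := @edge_label r.+1 q (p, v).
  have F0P : F0 \in level P r.+2 by exact: edge_label_mem.
  have inF F : F \in level P r.+2 -> GF F p v = (F == F0).
    move=> FP; apply/idP/eqP => [pvF|->]; last exact: mem_edge_label.
    exact/esym/edge_labelE.
  case cF: (c F0).
    rewrite (bigD1 F0) /= ?F0P ?cF // inF // eqxx big1 ?addr0 //.
    by move=> F /andP[/andP[FP _] /negPf ne]; rewrite inF // ne.
  rewrite big1 // => F /andP[FP cF']; rewrite inF //.
  by case: eqP => // eqF; rewrite eqF cF in cF'.
move=> F /= /andP[FP _].
set A := fiber _ (edge_label q p0); set B := fiber _ _.
have [/existsP[[p v] /and3P[/= pA vB pvF]]|] :=
  boolP [exists pv : points M r * point, [&& pv.1 \in A, pv.2 \in B & GF F pv.1 pv.2]];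
  last first.
  rewrite negb_exists => /forallP none; apply: (@eq_in_regular _ _ _ (fun _ _ => false)).
    move=> p v pA vB; have := none (p, v); rewrite /= pA vB /= => /negPf ->.
    by [].
  move=> A' B' *; have -> : edge_count rat (fun _ _ => false) A B = 0.
    by rewrite /edge_count big1 // => x _; rewrite big1.
  by rewrite mul0r !mulr_ge0 ?ler0n // edge_count_ge0.
have le_r2 : (2 <= r.+2 <= k.-1)%N by [].
have [W [E uF]] := (kpartP.2 _ le_r2).2 _ FP.
have [i eqE eqW] := under_last le_r uF pvF.
have {}pA : edge_label q p = edge_label q p0 by apply/eqP; move: pA; rewrite inE.
have {}vB : vertex_label (q + r.+1) v = vertex_label (q + r.+1) v0.
  by apply/eqP; move: vB; rewrite inE.
have le_r1 : (r.+1 <= k.-1)%N by lia.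
have := @goodP r.+2 le_r2 F FP W E uF i.
rewrite eqE eqW pA vB -(aux_left_fiber q p0 le_r1) -(aux_right_fiber (q + r.+1) v0).
move=> /(regular_pair_imset (inl_edge_inj lt_r) (@inr_vertex_inj _) d_gt0).
apply: eq_in_regular => p' v' pA' vB'.
have {}pA' : edge_label q p' = edge_label q p0 by apply/eqP; move: pA'; rewrite inE.
have {}vB' : vertex_label (q + r.+1) v' = vertex_label (q + r.+1) v0.
  by apply/eqP; move: vB'; rewrite inE.
have xi : (cyc (q + r.+1), v') \in W i by rewrite eqW vB -vB' mem_vertex_label.
rewrite mem_aux_graph xi /=.
have [pvF'|/negPf pvF'] := boolP (GF F p' v'); last first.
  by move: pvF'; rewrite /GF /= => ->; rewrite andbF.
move: (pvF'); rewrite /GF /= => ->; rewrite andbT.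
have [[[disjW _] WP _] /subsetP subF] := uF.
(* It remains to see that [edge q p'] meets each class other than [W i] once: the full edge meets
   every class once, and its last vertex lies in [W i]. *)
have : edge q p' \in polyad_part W E i by rewrite eqE pA -pA' mem_edge_label.
rewrite inE => /andP[_ sub_p]; rewrite inE sub_p /=.
apply/forallP => j; apply/implyP => ne.
have := subF _ pvF'; rewrite !inE => /andP[/andP[_ /forallP/(_ j)/= one] _].
move: one; rewrite setIUl (_ : [set _] :&: _ = set0) ?set0U //.
apply/eqP; rewrite setI_eq0 disjoints1; apply/negP => xj.
by have /disjointFr/(_ xj) := disjW _ _ ne; rewrite xi.
Qed.

End Partition.

(** * Density of the hypergraph and size of its regular partitions *)

Section LowerBound.
Variables k M : nat.
Hypothesis k_gt0 : (0 < k)%N.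
Variable pat : nat -> seq bool -> seq bool -> bool.
Hypothesis patP : forall d, (10 <= d <= M)%N -> pattern rat (2 ^ (d - 3)) d (pat d).
Hypothesis M_ge10 : (10 <= M)%N.

Local Notation point := (M.-tuple bool).
Local Notation vertex := ('I_(2 * k) * M.-tuple bool)%type.
Local Notation cyc := (cyc k_gt0).
Local Notation edge := (@edge k M k_gt0).
Local Notation vclass := (@vclass k M).

Definition tower_edges r s : {set points M r} :=
  [set p | [forall t : 'I_s, tower_bit pat p t]].

(* Each class is the last one of some rotation [a], so every round yields new
   bits on all classes at once. *)
Definition tower_hypergraph r s : {set {set vertex}} :=
  \bigcup_(a : 'I_(2 * k)) [set edge a p | p in tower_edges r s].

Lemma card_tower_edges r s : (forced_bits r s <= M)%N ->
  #|tower_edges r s|%:R = #|points M r|%:R / 2%:R ^+ s :> rat.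
Proof.
move=> le_M; have [_ eqF] := equidistributed_tower patP M_ge10 le_M.
have := eqF (fun u => (u == nseq s true)%:R).
rewrite avg_eq size_nseq eqxx mul1r => <-.
rewrite -sum1_card natr_sum big_mkcond /=; apply: eq_bigr => p _; rewrite inE.
suff -> : (tower_bits pat p s == nseq s true) = [forall t : 'I_s, tower_bit pat p t].
  by case: [forall _, _].
apply/eqP/forallP => [eqs t|all_t].
  have := congr1 (nth false ^~ t) eqs.
  by rewrite nth_mkseq // nth_nseq ltn_ord.
apply: (@eq_from_nth _ false); rewrite size_mkseq ?size_nseq // => t lt_t.
by rewrite nth_mkseq // nth_nseq lt_t (all_t (Ordinal lt_t)).
Qed.

Lemma card_tower_hypergraph r s :
  (#|tower_hypergraph r s| <= 2 * k * #|tower_edges r s|)%N.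
Proof.
apply: (@leq_trans (\sum_(a : 'I_(2 * k)) #|tower_edges r s|)).
  rewrite /tower_hypergraph; elim/big_rec2: _ => [|a n B _ le_n].
    by rewrite cards0.
  apply: (leq_trans (leq_card_setU _ _).1).
  by rewrite leq_add // leq_imset_card.
by rewrite sum_nat_const card_ord.
Qed.

(** An arc of at most [k] among [2 * k] cyclic classes determines its start: two distinct starts
    would each follow the other within [k - 1] steps, too few to close the cycle. *)
Lemma edge_shift_eq a b r (p p' : points M r) : (r < k)%N ->
  (a < 2 * k)%N -> (b < 2 * k)%N -> edge a p = edge b p' -> a = b.
Proof.
move=> lt_r lta ltb eqE.
have [x xp eqx] := edge_rep k_gt0 a p (leq0n r).
have [y yp eqy] := edge_rep k_gt0 b p' (leq0n r).
rewrite addn0 in eqx; rewrite addn0 in eqy.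
have [i le_i eqi] : exists2 i, (i <= r)%N & x.1 = cyc (b + i).
  by apply: (@edge_class k M k_gt0 b r p'); rewrite -eqE.
have [j le_j eqj] : exists2 j, (j <= r)%N & y.1 = cyc (a + j).
  by apply: (@edge_class k M k_gt0 a r p); rewrite eqE.
have mod_cases n : (n < 4 * k)%N ->
    (n %% (2 * k) = n \/ n %% (2 * k) + 2 * k = n)%N.
  move=> lt_n; have [lt|le] := ltnP n (2 * k); [left|right]; first exact: modn_small.
  rewrite -{1}(subnK le) modnDr modn_small ?subnK //; lia.
move: eqi eqj; rewrite eqx eqy => /(congr1 val) /= eqi /(congr1 val) /= eqj.
rewrite modn_small // in eqi; rewrite modn_small // in eqj.
have [|ci|ci] := mod_cases (b + i)%N; [lia | |];
  have [|cj|cj] := mod_cases (a + j)%N; lia.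
Qed.

Lemma edge_tower_hypergraph q r s (p : points M r) : (r < k)%N ->
  (edge q p \in tower_hypergraph r s) = (p \in tower_edges r s).
Proof.
move=> lt_r; have edge_cyc (p' : points M r) : edge q p' = edge (q %% (2 * k)) p'.
  have cycD n : cyc (q + n) = cyc (q %% (2 * k) + n).
    by apply: val_inj; rewrite /= modnDml.
  have cyc0 : cyc q = cyc (q %% (2 * k)) by apply: val_inj; rewrite /= modn_mod.
  by elim: r p' {lt_r p} => [|r IH] p' /=; rewrite ?cyc0 // IH cycD.
apply/bigcupP/idP => [[a _ /imsetP[p' p'H]]|pH].
  rewrite edge_cyc => eqE.
  have eqa := edge_shift_eq lt_r (ltn_pmod q (double_gt0 k_gt0)) (ltn_ord a) eqE.
  rewrite eqa in eqE; have lt_r2 : (r < 2 * k)%N by lia.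
  by rewrite (edge_inj lt_r2 eqE).
exists (cyc q) => //; rewrite edge_cyc; exact: imset_f.
Qed.

Section Uniformity.
Variables r s : nat.
Hypothesis eqk : r.+2 = k.
Hypothesis le_M : (forced_bits r.+1 s <= M)%N.

Local Notation H := (tower_hypergraph r.+1 s).

Lemma card_edge_class q (p : points M r.+1) i : #|edge q p :&: vclass i| = 1%N.
Proof.
rewrite card_edge_vclass; last by lia.
have : (\sum_(0 <= a < r.+2) ((q + a) %% k == i) = 1)%N.
  by rewrite eqk big_mkord sum_modn.
by rewrite big_mkord.
Qed.

Lemma tower_hypergraph_partite : partite k vclass H.
Proof.
split=> [|e /bigcupP[a _ /imsetP[p _ ->]]]; first exact: vclass_disjoint.
split=> [||i]; last by rewrite card_edge_class.
- by rewrite card_edge; lia.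
by rewrite vclass_cover // subsetT.
Qed.

Lemma card_points n : #|points M n| = (2 ^ (M * n.+1))%N.
Proof.
elim: n => [|n IH] /=; first by rewrite card_tuple card_bool muln1.
by rewrite card_prod IH card_tuple card_bool -expnD -mulnSr.
Qed.

(** The edges of rotation 0 suffice: they are a proportion [2 ^ -s] of the tuples, and the classes
    have [2 * 2 ^ M] vertices, which costs the factor [2 ^ k]. *)
Lemma tower_hypergraph_density : (2%:R : rat) ^- (s + k) <= density vclass H.
Proof.
have le_H : (#|tower_edges r.+1 s| <= #|H|)%N.
  have lt_r : (r.+1 < 2 * k)%N by lia.
  rewrite -(card_imset _ (@edge_inj k M k_gt0 0 _ lt_r)); apply: subset_leq_card.
  apply/subsetP => e /imsetP[p pH ->]; rewrite edge_tower_hypergraph //; lia.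
have eq_prod : (\prod_(i < k) #|vclass i| = 2 ^ k * 2 ^ (M * k))%N.
  rewrite (eq_bigr (fun=> 2 * 2 ^ M)%N) => [|i _]; last by rewrite card_vclass.
  by rewrite prod_nat_const card_ord expnMn -expnM.
rewrite /density eq_prod ler_pdivlMr ?ltr0n ?muln_gt0 ?expn_gt0 //.
move: le_H; rewrite -(ler_nat rat) card_tower_edges // card_points eqk.
apply: le_trans; rewrite natrM !natrX exprD invfM.
have pos n : (2%:R : rat) ^+ n != 0 by rewrite expf_neq0.
by rewrite -mulrA mulKf ?pos // mulrC.
Qed.

Section RegularPartition.
Variables (P : kpart vertex) (d : rat).
Hypothesis d_gt0 : 0 < d.
Hypothesis le_d : (2 * k)%:R * d <= threshold rat r.+1.
Hypothesis regP : regular_partition d vclass H P.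
Hypothesis refP : refines (vparts P) (initial_partition k M).

Local Notation edge_label := (edge_label k_gt0 P).
Local Notation vertex_label := (vertex_label k_gt0 P).

Lemma regular_kpartition : kpartition k.-1 setT P.
Proof. by case: regP; rewrite vclass_cover. Qed.

Lemma regular_good : good k.-1 d P. Proof. by case: regP. Qed.

Lemma labels_refine10 : vertices_refine rat vertex_label 10.
Proof.
move=> q.
pose c (Z : {set vertex}) : seq bool :=
  if [pick x in Z] is Some x then (initial_label x).2 else [::].
exists c; rewrite (_ : [set _ | _] = set0); last first.
  apply/setP => v; rewrite !inE; apply/negbTE; rewrite negbK /c.
  have vZ := mem_vertex_label k_gt0 regular_kpartition q v.
  case: pickP => [x xZ|/(_ (cyc q, v))]; last by rewrite vZ.
  rewrite -(vparts_label refP (vertex_label_mem k_gt0 regular_kpartition q v) vZ xZ) /=.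
  have szv : size (take 10 v) = 10 by rewrite size_takel // size_tuple.
  apply/eqP; apply: (@eq_from_nth _ false); first by rewrite szv size_map size_enum_ord.
  move=> i; rewrite szv => lti; rewrite nth_take //.
  rewrite (nth_map (Ordinal lti)) ?size_enum_ord //.
  by rewrite (nth_ord_enum _ (Ordinal lti)).
rewrite cards0; apply: mulr_ge0; last exact: ler0n.
by rewrite invr_ge0; exact: ler0n.
Qed.

Lemma edge_label0_refines q j g :
  approx_refines (@edge_label 0 q) (fun v : point => take j (tval v)) g ->
  approx_refines (vertex_label q) (fun v => take j (tval v)) (g : rat).
Proof.
case=> c cP; exists (c \o @singletons k M); apply: le_trans cP.
rewrite ler_nat; apply: subset_leq_card; apply/subsetP => v.
by rewrite !inE /= (edge_label0 _ regular_kpartition).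
Qed.

Lemma d_le_threshold n : (n <= r.+1)%N -> d <= threshold rat n.
Proof.
move=> le_n; have le_d1 : d <= threshold rat r.+1.
  apply: le_trans le_d; rewrite ler_peMl ?(ltW d_gt0) // ler1n; lia.
apply: (le_trans le_d1); rewrite /threshold lef_pV2 ?posrE ?exprn_gt0 //.
by rewrite ler_weXn2l ?ler1n // leq_mul2l.
Qed.

(** Goodness of [P] carries forcing up to [k - 1]-tuples; regularity with respect to the hypergraph
    supplies the last level. *)
Lemma forces_labels n : (n.+1 < k)%N -> forces rat pat (@edge_label) vertex_label n.
Proof.
elim: n => [|n IH] lt_n; first exact: (forces0 M_ge10 edge_label0_refines).
apply: (forcesS patP M_ge10 labels_refine10 (IH (ltnW lt_n))) => q c p0 v0.
apply: (@regular_weaken _ _ _ _ _ _ d); first by apply: d_le_threshold; lia.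
apply: (good_label_regular regular_kpartition refP _ regular_good d_gt0); lia.
Qed.

(** An edge of the hypergraph has a single vertex in [vclass i], so it arises from one pair only. *)
Lemma card_aux_graph i : (#|aux_graph vclass H i| <= #|H|)%N.
Proof.
apply: leq_trans (leq_imset_card _ _) _.
set S := [set q | _].
have S_notin (e : {set vertex}) x : (e, x) \in S ->
    [/\ x \in vclass i, x |: e \in H & x \notin e].
  rewrite inE /= => /and3P[]; rewrite inE => /andP[/subsetP sub_e _] xi ->; split=> //.
  apply/negP => /sub_e /bigcupP[j /= ne xj].
  by have /disjointFr/(_ xj) := @vclass_disjoint k M _ _ ne; rewrite xi.
pose f (p : {set vertex} * vertex) := p.2 |: p.1.
have f_inj : {in S &, injective f}.
  move=> [e x] [e' x'] eS eS' eqf.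
  have [xi xH xe] := S_notin _ _ eS; have [xi' xH' xe'] := S_notin _ _ eS'.
  rewrite /f /= in eqf.
  have eqx : x = x'.
    case/bigcupP: xH => a _ /imsetP[p _ eqp].
    have /cards1P[y eqy] : #|(x |: e) :&: vclass i| == 1%N.
      by rewrite eqp card_edge_class.
    have : x \in (x |: e) :&: vclass i by rewrite inE setU11.
    have : x' \in (x |: e) :&: vclass i by rewrite inE eqf setU11.
    by rewrite eqy => /set1P -> /set1P ->.
  by rewrite -{}eqx in eqf xe' *; rewrite -(setU1K xe) eqf (setU1K xe').
rewrite -(card_in_imset f_inj); apply: subset_leq_card.
by apply/subsetP => g /imsetP[[e x] /S_notin[_ xH _] ->].
Qed.

Lemma tower_graphE n (p : points M r) (v : point) :
  tower_graph pat n (fun=> true) p v = (((p, v) : points M r.+1) \in tower_edges r.+1 n).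
Proof. by rewrite inE; apply: eq_forallb => t; rewrite eqb_id. Qed.

(** The rotation starting at [q] sits inside the auxiliary graph of the class containing its last
    vertices, and the edited graph is restricted to it. *)
Lemma hypergraph_regular_approx : regular_approx rat pat (@edge_label) vertex_label r s.
Proof.
move=> q; pose i : 'I_k := Ordinal (ltn_pmod (q + r.+1) k_gt0).
have [_ _ _ /(_ i)[_ [G [_ edits reg]]]] := regP.
have lt_r : (r < 2 * k)%N by lia.
have lt_r1 : (r.+1 < k)%N by lia.
have cyc_i v : (cyc (q + r.+1), v) \in vclass i.
  by rewrite inE /= modn_dvdm // dvdn_mull.
pose f (pv : points M r * point) : {set {set vertex} + vertex} :=
  [set inl (edge q pv.1); inr (cyc (q + r.+1), pv.2)].
have f_inj : injective f.
  move=> [p v] [p' v'] eqf.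
  have : inl (edge q p) \in f (p', v') by rewrite -eqf set21.
  have : inr (cyc (q + r.+1), v) \in f (p', v') by rewrite -eqf set22.
  rewrite !in_set2 => /orP[/eqP//|/eqP[->]] /orP[/eqP[]|/eqP//].
  by move=> /(edge_inj lt_r) ->.
have graphE p v : tower_graph pat s (fun=> true) p v = (f (p, v) \in aux_graph vclass H i).
  rewrite tower_graphE mem_aux_graph cyc_i (edge_prod k_gt0 p eqk (erefl : i = _ :> nat)) /=.
  by rewrite -(edge_tower_hypergraph q s _ lt_r1).
have le_k1 : (r.+1 <= k.-1)%N by lia.
exists (fun=> true), (fun p v => f (p, v) \in G); split.
  have -> : edge_count rat (@tower_graph M pat r s (fun=> true)) setT setT =
      #|tower_edges r.+1 s|%:R.
    rewrite edge_countT -sum1_card natr_sum [RHS]big_mkcond /=; apply: eq_bigr => -[p v] _.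
    by rewrite tower_graphE; case: (_ \in _).
  apply: (@le_trans _ _ (d * #|aux_graph vclass H i|%:R)).
    apply: le_trans edits; rewrite edge_countT.
    pose D := [set pv | (f pv \in aux_graph vclass H i) != (f pv \in G)].
    have -> : \sum_(pv : points M r * point) (tower_graph pat s (fun=> true) pv.1 pv.2 !=
        (f (pv.1, pv.2) \in G))%:R = #|D|%:R :> rat.
      rewrite -sum1_card natr_sum [RHS]big_mkcond /=; apply: eq_bigr => -[p v] _.
      by rewrite graphE inE; case: (_ != _).
    rewrite ler_nat -(card_imset _ f_inj); apply: subset_leq_card.
    apply/subsetP => _ /imsetP[pv pvD ->]; move: pvD; rewrite !inE.
    by case: (_ \in aux_graph _ _ _); case: (_ \in G).
  (* Edits are measured against all [2 * k] rotations together, so the bound relative to a single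
     one is weaker by this factor; [le_d] allows for it. *)
  apply: (@le_trans _ _ (d * (2 * k * #|tower_edges r.+1 s|)%:R)).
    rewrite ler_wpM2l ?(ltW d_gt0) // ler_nat.
    exact: leq_trans (card_aux_graph i) (card_tower_hypergraph _ _).
  by rewrite natrM mulrA ler_wpM2r ?ler0n // mulrC.
move=> p0 v0; apply: (@regular_weaken _ _ _ _ _ _ d); first exact: d_le_threshold.
apply: (regular_pair_imset (@inl_edge_inj _ _ k_gt0 q r lt_r)
  (@inr_vertex_inj _ _ k_gt0 (q + r.+1)) d_gt0).
have kP := regular_kpartition.
rewrite (aux_left_fiber k_gt0 kP refP q p0 le_k1) (aux_right_fiber k_gt0 kP refP).
have lP := edge_label_mem k_gt0 kP refP q p0 le_k1.
apply: reg.
- apply/setUP; left; apply: imset_f; rewrite inE -{1}(_ : r.+1 = k.-1) ?lP; last by lia.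
  have pP := mem_edge_label k_gt0 kP refP q p0 le_k1.
  apply/subsetP => e /(level_edges kP refP le_k1 lP pP)[p ->].
  exact: edge_prod.
- apply/setUP; right; apply: imset_f; rewrite inE (vertex_label_mem k_gt0 kP) /=.
  apply/subsetP => x xZ.
  have [eq1 _] := vparts_label refP (vertex_label_mem k_gt0 kP _ v0)
    (mem_vertex_label k_gt0 kP _ v0) xZ.
  by have := cyc_i v0; rewrite !inE -eq1.
apply/eqP => /setP/(_ (inl (edge q p0))).
rewrite imset_f ?(mem_edge_label k_gt0 kP refP) // => /esym/imsetP[x _].
by [].
Qed.

(** Once all [M] bits are forced, the part determines the vertex on class 0, up to a proportion
    1/128 of exceptions. *)
Lemma vparts_lower_bound : (M <= forced_bits r.+1 s)%N ->
  (127 * 2 ^ M <= 128 * #|vparts P|)%N.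
Proof.
move=> le_forced; have lt_rk : (r.+1 < k)%N by lia.
have [c cP] := regular_approx_refine patP M_ge10 labels_refine10
  (forces_labels lt_rk) le_M hypergraph_regular_approx (leqnn s) 0.
set bad := [set v | _] in cP.
have badE v : v \notin bad -> tval v = c (vertex_label 0 v).
  by rewrite inE negbK => /eqP; rewrite take_oversize // size_tuple.
have le_good : (#|~: bad| <= #|vparts P|)%N.
  have inj : {in ~: bad &, injective (vertex_label 0)}.
    move=> v v'; rewrite !in_setC => nv nv' eqv; apply: val_inj.
    by rewrite /= (badE _ nv) (badE _ nv') eqv.
  rewrite -(card_in_imset inj); apply: subset_leq_card.
  by apply/subsetP => _ /imsetP[v _ ->]; exact: (vertex_label_mem k_gt0 regular_kpartition).
have le_bad : (128 * #|bad| <= 2 ^ M)%N.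
  move: cP; rewrite card_tuple card_bool ler_pdivlMl; last by rewrite ltr0n.
  by rewrite -natrM ler_nat.
have := cardsC bad; rewrite card_tuple card_bool; lia.
Qed.

End RegularPartition.
End Uniformity.
End LowerBound.

Lemma leq_16exp k : (11 * k.+1 + 1 <= 16 ^ k.+1)%N.
Proof. by elim: k => // k IH; rewrite expnS; lia. Qed.

(** In exponents, [2 * k] costs at most [k + 1] and the threshold [10 * k]; together
    [11 * k + 1 <= 16 ^ k]. *)
Lemma regularity_threshold r (k := r.+2) :
  (2 * k)%:R * (2%:R : rat) ^- (16 ^ k) <= threshold rat r.+1.
Proof.
rewrite /threshold -/k ler_pdivrMr ?exprn_gt0 // ler_pdivlMl ?exprn_gt0 //.
rewrite -!natrX -natrM ler_nat.
apply: (@leq_trans (2 ^ (10 * k) * 2 ^ k.+1)).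
  by rewrite leq_mul2l expnS leq_mul2l ltnW ?orbT // ltn_expl.
by rewrite -expnD leq_exp2l //; have := leq_16exp r.+1; rewrite -/k; lia.
Qed.

Local Close Scope ring_scope.

Theorem theorem3 (k : nat) (hk : 2 <= k) (s : nat) :
  exists (T : finType) (V : 'I_k -> {set T}) (H : {set {set T}})
         (V0 : {set {set T}}),
    [/\ partite k V H,
        ((2%:R : rat) ^- (s + k) <= density V H)%R,
        partition V0 (\bigcup_i V i),
        #|V0| <= 2 ^ 200 * k &
        forall P : kpart T,
          regular_partition ((2%:R : rat) ^- (16 ^ k))%R V H P ->
          refines (vparts P) V0 ->
          Ack k s <= #|vparts P|].
Proof.
case: k hk => [|[|r]] // hk.
(* Points have exactly as many bits as [s] rounds force, so these rounds determine vertices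
   completely. *)
set k := r.+2; set M := forced_bits r.+1 s.
have k_gt0 : 0 < k by [].
have gr := grows_forced_bits r.
have le_Ack : Ack k s + 4 <= M.
  by apply: leq_trans (Ack_right_len gr s) _; exact: leq_subr.
have M_ge10 : 10 <= M.
  by apply: leq_trans (right_len_ge10 gr s) _; exact: leq_subr.
have [pat patP] : exists pat : nat -> seq bool -> seq bool -> bool,
    forall d, 10 <= d <= M -> pattern rat (2 ^ (d - 3)) d (pat d).
  (* Restricting to the finitely many [d <= M] makes the choice of patterns constructive; below 10
     the pattern is a dummy. *)
  have ex (d : 'I_M.+1) : exists f, 10 <= d -> pattern rat (2 ^ (d - 3)) d f.
    have [le_d|] := boolP (10 <= d); last by exists (fun _ _ => false).
    have [|f fP] := @exists_pattern rat d; first by exact: leq_trans le_d.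
    by exists f.
  have [pat patP] := fin_all_exists ex.
  exists (fun d => pat (inord d)) => d /andP[le_d le_dM].
  by have := patP (inord d); rewrite inordK //; apply.
have eqk : r.+2 = k by [].
have le_M : forced_bits r.+1 s <= M by [].
exists ('I_(2 * k) * M.-tuple bool)%type, (@vclass k M),
  (@tower_hypergraph k M k_gt0 pat r.+1 s), (initial_partition k M).
split.
- exact: tower_hypergraph_partite.
- exact: (tower_hypergraph_density k_gt0 patP M_ge10 eqk le_M).
- by rewrite vclass_cover //; exact: initial_partitionP.
- apply: leq_trans (card_initial_partition _ _) _.
  by rewrite leq_mul2r leq_exp2l ?orbT.
move=> P regP refP.
have d_gt0 : (0 < (2%:R : rat) ^- (16 ^ k))%R by rewrite invr_gt0 exprn_gt0.
have := vparts_lower_bound patP M_ge10 eqk le_M d_gt0 (regularity_threshold r) regP refP le_M.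
(* The spare factor 16 in [2 ^ M] absorbs the loss of 127/128. *)
have : 2 ^ (Ack k s + 4) <= 2 ^ M by rewrite leq_exp2l.
rewrite expnD; have := ltn_expl (Ack k s) (isT : 1 < 2).
by move: (2 ^ M) (2 ^ Ack k s) => ? ?; lia.
Qed.
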